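(* Let $(\mathfrak M,\mathcal H)$ be a bicocycle double cross product pair over a field $k$, with distinguished group-likes $e\in\mathfrak M$, $1\in\mathcal H$ and structure maps $\varphi,\psi,\phi,\theta,\mu,\gamma$ (with $x\cdot x'=\phi(x,x')$ and $h\ast h'=\mu(h,h')$). Then $\mathcal G:=\mathfrak M\otimes\mathcal H$ is a bialgebra through $$(x\otimes h)(x'\otimes h'):=x_{(1)}\cdot[\varphi(h_{(1)},x'_{(1)})\cdot\gamma(\psi(h_{(2)},x'_{(2)}),h'_{(1)})]\otimes[\theta(x_{(2)},\varphi(h_{(3)},x'_{(3)}))\ast\psi(h_{(4)},x'_{(4)})]\ast h'_{(2)}$$ and $$\Delta(x\otimes h):=(x_{(1)}\otimes h_{(1)})\otimes(x_{(2)}\otimes h_{(2)}),$$ with the unit $e\otimes1\in\mathfrak M\otimes\mathcal H$ and the counit $\varepsilon(x\otimes h):=\varepsilon(x)\varepsilon(h)$, if and only if the following hold for any $x,x',x''\in\mathfrak M$ and any $h,h',h''\in\mathcal H$: 1. $e\cdot x=x=x\cdot e$ and $1\ast h=h=h\ast1$; 2. $\theta(x,e)=\varepsilon(x)1=\theta(e,x)$ and $\gamma(h,1)=\varepsilon(h)e=\gamma(1,h)$; 3. $\varphi(h_{(1)},x'_{(1)}\cdot x''_{(1)})\cdot\gamma(\psi(h_{(2)},x'_{(2)}\cdot x''_{(2)}),\theta(x'_{(3)},x''_{(3)})\ast h'')=\varphi(h_{(1)},x'_{(1)})\cdot[\varphi(\psi(h_{(2)},x'_{(2)}),x''_{(1)})\cdot\gamma(\psi(\psi(h_{(3)},x'_{(3)}),x''_{(2)}),h'')]$;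 4. $\psi(h,x'_{(1)}\cdot x''_{(1)})\ast[\theta(x'_{(2)},x''_{(2)})\ast h'']=[\theta(\varphi(h_{(1)},x'_{(1)}),\varphi(\psi(h_{(2)},x'_{(2)}),x''_{(1)}))\ast\psi(\psi(h_{(3)},x'_{(3)}),x''_{(2)})]\ast h''$; 5. $\theta(x\cdot\gamma(h_{(1)},h'_{(1)}),\varphi(h_{(2)}\ast h'_{(2)},x''_{(1)}))\ast\psi(h_{(3)}\ast h'_{(3)},x''_{(2)})=[\theta(x,\varphi(h_{(1)},\varphi(h'_{(1)},x''_{(1)})))\ast\psi(h_{(2)},\varphi(h'_{(2)},x''_{(2)}))]\ast\psi(h'_{(3)},x''_{(3)})$; 6. $[x\cdot\gamma(h_{(1)},h'_{(1)})]\cdot\varphi(h_{(2)}\ast h'_{(2)},x'')=x\cdot[\varphi(h_{(1)},\varphi(h'_{(1)},x''_{(1)}))\cdot\gamma(\psi(h_{(2)},\varphi(h'_{(2)},x''_{(2)})),\psi(h'_{(3)},x''_{(3)}))]$; 7. $\varepsilon(h'')\,x\cdot(x'\cdot x'')=(x_{(1)}\cdot x'_{(1)})\cdot[\varphi(\theta(x_{(2)},x'_{(2)}),x''_{(1)})\cdot\gamma(\psi(\theta(x_{(3)},x'_{(3)}),x''_{(2)}),h'')]$; 8. $\theta(x,x'_{(1)}\cdot x''_{(1)})\ast[\theta(x'_{(2)},x''_{(2)})\ast h'']=[\theta(x_{(1)}\cdot x'_{(1)},\varphi(\theta(x_{(2)},x'_{(2)}),x''_{(1)}))\ast\psi(\theta(x_{(3)},x'_{(3)}),x''_{(2)})]\ast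 h''$; 9. $[x\cdot\gamma(h_{(1)},h'_{(1)})]\cdot\gamma(h_{(2)}\ast h'_{(2)},h'')=x\cdot[\varphi(h_{(1)},\gamma(h'_{(1)},h''_{(1)}))\cdot\gamma(\psi(h_{(2)},\gamma(h'_{(2)},h''_{(2)})),h'_{(3)}\ast h''_{(3)})]$; 10. $\varepsilon(x)\,(h\ast h')\ast h''=[\theta(x,\varphi(h_{(1)},\gamma(h'_{(1)},h''_{(1)})))\ast\psi(h_{(2)},\gamma(h'_{(2)},h''_{(2)}))]\ast(h'_{(3)}\ast h''_{(3)})$; 11. $\psi(h_{(2)},x_{(2)})\otimes\varphi(h_{(1)},x_{(1)})=\psi(h_{(1)},x_{(1)})\otimes\varphi(h_{(2)},x_{(2)})$; 12. $\theta(x_{(2)},x'_{(2)})\otimes x_{(1)}\cdot x'_{(1)}=\theta(x_{(1)},x'_{(1)})\otimes x_{(2)}\cdot x'_{(2)}$; 13. $h_{(2)}\ast h'_{(2)}\otimes\gamma(h_{(1)},h'_{(1)})=h_{(1)}\ast h'_{(1)}\otimes\gamma(h_{(2)},h'_{(2)})$.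
   Context: Sweedler notation $\Delta(x)=x_{(1)}\otimes x_{(2)}$ is used for comultiplications, $\varepsilon$ denotes counits, summations are suppressed. A bicocycle double cross product pair $(\mathfrak M,\mathcal H)$ consists of two coalgebras $(\mathfrak M,e)$ and $(\mathcal H,1)$ with distinguished group-likes $e\in\mathfrak M$, $1\in\mathcal H$, and coalgebra maps $$\varphi:\mathcal H\otimes\mathfrak M\to\mathfrak M,\quad\psi:\mathcal H\otimes\mathfrak M\to\mathcal H,\quad\phi:\mathfrak M\otimes\mathfrak M\to\mathfrak M,\ \phi(x,x')=:x\cdot x',$$ $$\theta:\mathfrak M\otimes\mathfrak M\to\mathcal H,\quad\mu:\mathcal H\otimes\mathcal H\to\mathcal H,\ \mu(h,h')=:h\ast h',\quad\gamma:\mathcal H\otimes\mathcal H\to\mathfrak M$$ (for the tensor product coalgebra structures on the domains) satisfying, for all $x\in\mathfrak M$, $h\in\mathcal H$, $\varphi(1,x)=x$, $\psi(h,e)=h$, $\varphi(h,e)=\varepsilon(h)e$, $\psi(1,x)=\varepsilon(x)1$, $\theta(e,e)=1$, $\mu(1,1)=1$, $\phi(e,e)=e$, $\gamma(1,1)=e$. The operations $\cdot$ and $\ast$ are not assumed associative. *)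

(* Defs.v *)
From HB Require Import structures.
From mathcomp Require Import all_boot all_order all_algebra.
From mathcomp Require Import boolp.

Set Implicit Arguments.
Unset Strict Implicit.
Unset Printing Implicit Defensive.

Import GRing.Theory.
Local Open Scope ring_scope.
Local Open Scope quotient_scope.

Reserved Notation "U \otimes V" (at level 40, left associativity).
Reserved Notation "u \ox v" (at level 40, left associativity).

Definition bilinear_map (k : fieldType) (U V W : lmodType k)
    (f : U -> V -> W) : Prop :=
  (forall v, linear (f^~ v)) /\ (forall u, linear (f u)).

Section TensorProduct.
Variables (k : fieldType) (U V : lmodType k).

(* A list [:: (u1, v1); ...; (un, vn)] stands for the formal sum of the
   ui \ox vi, and tens_eq is the congruence generated by bilinearity. *)
Inductive tens_eq : seq (U * V) -> seq (U * V) -> Prop :=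
| tens_refl s : tens_eq s s
| tens_sym s t : tens_eq s t -> tens_eq t s
| tens_trans s t r : tens_eq s t -> tens_eq t r -> tens_eq s r
| tens_cat s s' t t' : tens_eq s s' -> tens_eq t t' ->
    tens_eq (s ++ t) (s' ++ t')
| tens_catC s t : tens_eq (s ++ t) (t ++ s)
| tens_addl u u' v : tens_eq [:: (u + u', v)] [:: (u, v); (u', v)]
| tens_addr u v v' : tens_eq [:: (u, v + v')] [:: (u, v); (u, v')]
| tens_scale (a : k) u v : tens_eq [:: (a *: u, v)] [:: (u, a *: v)]
| tens_zero v : tens_eq [:: (0, v)] [::].

Definition tens_rel : rel (seq (U * V)) := fun s t => `[< tens_eq s t >].

Lemma tens_rel_equiv : equiv_class_of tens_rel.
Proof.
split=> [s|s t|t s r].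
- by apply/asboolP; apply: tens_refl.
- by apply/asboolP/asboolP; apply: tens_sym.
- by move=> /asboolP st /asboolP tr; apply/asboolP; apply: tens_trans st tr.
Qed.

Canonical tens_equiv_rel := EquivRelPack tens_rel_equiv.

Definition tens : Type := {eq_quot tens_equiv_rel}.

HB.instance Definition _ := Choice.on tens.
HB.instance Definition _ := EqQuotient.on tens.

Definition tmk (s : seq (U * V)) : tens := \pi_tens s.

Lemma tmkK (t : tens) : tmk (repr t) = t.
Proof. exact: reprK. Qed.

Lemma tmkP s t : tmk s = tmk t <-> tens_eq s t.
Proof.
rewrite /tmk; split; first by move/eqquotP => /asboolP.
by move=> st; apply/eqquotP/asboolP.
Qed.

Lemma repr_tmk s : tens_eq (repr (tmk s)) s.
Proof. by apply/tmkP; rewrite tmkK. Qed.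

Definition tens_add (s t : tens) : tens := tmk (repr s ++ repr t).
Definition tscale_seq (a : k) (s : seq (U * V)) := [seq (a *: p.1, p.2) | p <- s].
Definition tens_opp (s : tens) : tens := tmk (tscale_seq (-1) (repr s)).
Definition tens_scl (a : k) (s : tens) : tens := tmk (tscale_seq a (repr s)).

Lemma tmkD s t : tens_add (tmk s) (tmk t) = tmk (s ++ t).
Proof. by apply/tmkP; apply: tens_cat; apply: repr_tmk. Qed.

Lemma tscale_eq a s t :
  tens_eq s t -> tens_eq (tscale_seq a s) (tscale_seq a t).
Proof.
elim=> {s t} /=.
- by move=> s; apply: tens_refl.
- by move=> s t _; apply: tens_sym.
- by move=> s t r _ st _; apply: tens_trans st.
- by move=> s s' t t' _ h _ h'; rewrite /tscale_seq !map_cat; apply: tens_cat.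
- by move=> s t; rewrite /tscale_seq !map_cat; apply: tens_catC.
- by move=> u u' v; rewrite scalerDr; apply: tens_addl.
- by move=> u v v'; apply: tens_addr.
- by move=> b u v; rewrite scalerA mulrC -scalerA; apply: tens_scale.
- by move=> v; rewrite scaler0; apply: tens_zero.
Qed.

Lemma tmkZ a s : tens_scl a (tmk s) = tmk (tscale_seq a s).
Proof. by apply/tmkP; apply: tscale_eq; apply: repr_tmk. Qed.

Lemma tmkN s : tens_opp (tmk s) = tmk (tscale_seq (-1) s).
Proof. exact: tmkZ. Qed.

Lemma tscale_add a b s :
  tens_eq (tscale_seq (a + b) s) (tscale_seq a s ++ tscale_seq b s).
Proof.
elim: s => [|[u v] s IHs]; first exact: tens_refl.
rewrite /= -cat1s scalerDl.
apply: tens_trans (tens_cat (tens_addl _ _ _) IHs) _.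
rewrite -[X in tens_eq _ X]cat1s -[X in tens_eq X _]/([:: _] ++ ([:: _] ++ _)).
apply: tens_cat; first exact: tens_refl.
rewrite catA -[X in tens_eq _ (_ ++ X)]cat1s catA.
by apply: tens_cat; [apply: tens_catC | apply: tens_refl].
Qed.

Lemma tscale0 s : tens_eq (tscale_seq 0 s) [::].
Proof.
elim: s => [|[u v] s IHs]; first exact: tens_refl.
rewrite /= scale0r -cat1s -[X in tens_eq _ X]/([::] ++ [::]).
by apply: tens_cat IHs; apply: tens_zero.
Qed.

Lemma tscale1 s : tscale_seq 1 s = s.
Proof. by elim: s => //= -[u v] s ->; rewrite scale1r. Qed.

Lemma tens_addA : associative tens_add.
Proof. by move=> r s t; rewrite -[r]tmkK -[s]tmkK -[t]tmkK !tmkD catA. Qed.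

Lemma tens_addC : commutative tens_add.
Proof.
by move=> s t; rewrite -[s]tmkK -[t]tmkK !tmkD; apply/tmkP/tens_catC.
Qed.

Lemma tens_add0 : left_id (tmk [::]) tens_add.
Proof. by move=> s; rewrite -[s]tmkK tmkD. Qed.

Lemma tens_addN : left_inverse (tmk [::]) tens_opp tens_add.
Proof.
move=> s; rewrite -[s]tmkK tmkN tmkD -{2}[repr s]tscale1; apply/tmkP.
apply: tens_trans (tens_sym (tscale_add _ _ _)) _.
by rewrite addNr; apply: tscale0.
Qed.

HB.instance Definition _ :=
  GRing.isZmodule.Build tens tens_addA tens_addC tens_add0 tens_addN.

Lemma tens_sclA a b t : tens_scl a (tens_scl b t) = tens_scl (a * b) t.
Proof.
rewrite -[t]tmkK !tmkZ /tscale_seq -map_comp; congr tmk.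
by apply: eq_map => -[u v] /=; rewrite scalerA.
Qed.

Lemma tens_scl1 : left_id 1 tens_scl.
Proof. by move=> t; rewrite -[t]tmkK tmkZ tscale1. Qed.

Lemma tens_sclDr : right_distributive tens_scl +%R.
Proof.
move=> a s t; rewrite -[s]tmkK -[t]tmkK -[_ + _ in LHS]/(tens_add _ _) tmkD.
by rewrite !tmkZ -[RHS]/(tens_add _ _) tmkD /tscale_seq map_cat.
Qed.

Lemma tens_sclDl t : {morph tens_scl^~ t : a b / a + b}.
Proof.
move=> a b; rewrite -[t]tmkK !tmkZ -[RHS]/(tens_add _ _) tmkD.
by apply/tmkP/tscale_add.
Qed.

HB.instance Definition _ := GRing.Zmodule_isLmodule.Build k tens
  tens_sclA tens_scl1 tens_sclDr tens_sclDl.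

Definition ptens (u : U) (v : V) : tens := tmk [:: (u, v)].

(* [lift f t] is the value at t of the linear map on the tensor product that is
   induced by f; it is only meaningful for bilinear f, see liftE and liftP.
   For other f it depends on the chosen representative of t. *)
Definition lift (W : lmodType k) (f : U -> V -> W) (t : tens) : W :=
  \sum_(p <- repr t) f p.1 p.2.

End TensorProduct.

Notation "U \otimes V" := (tens U V) : type_scope.
Notation "u \ox v" := (ptens u v) : ring_scope.

Section TensorTheory.
Variables (k : fieldType).
Implicit Types U V W : lmodType k.

Lemma tmkDE U V (s t : seq (U * V)) : tmk s + tmk t = tmk (s ++ t).
Proof. exact: tmkD. Qed.

Lemma tmkZE U V a (s : seq (U * V)) : a *: tmk s = tmk (tscale_seq a s).
Proof. exact: tmkZ. Qed.

Lemma ptens_bilinear U V : bilinear_map (@ptens k U V).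
Proof.
split=> [v a u u'|u a v v']; rewrite /ptens tmkZE tmkDE; apply/tmkP.
  exact: tens_addl.
apply: tens_trans (tens_addr _ _ _) _.
apply: (tens_cat (s := [:: _]) (s' := [:: _])); last exact: tens_refl.
by apply: tens_sym; apply: tens_scale.
Qed.

Lemma tensE U V (t : U \otimes V) : t = \sum_(p <- repr t) p.1 \ox p.2.
Proof.
rewrite -{1}[t]tmkK; elim: (repr t) => [|[u v] s IHs]; first by rewrite big_nil.
by rewrite big_cons -IHs /ptens tmkDE.
Qed.

Section Lift.
Variables (U V W : lmodType k) (f : U -> V -> W).
Hypothesis fbil : bilinear_map f.

Let fDl u u' v : f (u + u') v = f u v + f u' v.
Proof. by have := fbil.1 v 1 u u'; rewrite !scale1r. Qed.

Let fDr u v v' : f u (v + v') = f u v + f u v'.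
Proof. by have := fbil.2 u 1 v v'; rewrite !scale1r. Qed.

Let f0l v : f 0 v = 0.
Proof. by apply: (addrI (f 0 v)); rewrite -fDl !addr0. Qed.

Let f0r u : f u 0 = 0.
Proof. by apply: (addrI (f u 0)); rewrite -fDr !addr0. Qed.

Let fZl a u v : f (a *: u) v = a *: f u v.
Proof. by have := fbil.1 v a u 0; rewrite !addr0 f0l addr0. Qed.

Let fZr a u v : f u (a *: v) = a *: f u v.
Proof. by have := fbil.2 u a v 0; rewrite !addr0 f0r addr0. Qed.

Lemma tens_eq_sum s t : tens_eq s t ->
  \sum_(p <- s) f p.1 p.2 = \sum_(p <- t) f p.1 p.2.
Proof.
elim=> {s t} //.
- by move=> s t r _ -> _ ->.
- by move=> s s' t t' _ e _ e'; rewrite !big_cat /= e e'.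
- by move=> s t; rewrite !big_cat /= addrC.
- by move=> u u' v; rewrite !big_cons !big_nil !addr0 fDl.
- by move=> u v v'; rewrite !big_cons !big_nil !addr0 fDr.
- by move=> a u v; rewrite !big_cons !big_nil !addr0 fZl fZr.
- by move=> v; rewrite !big_cons !big_nil addr0 f0l.
Qed.

Lemma lift_tmk s : lift f (tmk s) = \sum_(p <- s) f p.1 p.2.
Proof. by apply: tens_eq_sum; apply: repr_tmk. Qed.

Lemma liftE u v : lift f (u \ox v) = f u v.
Proof. by rewrite lift_tmk big_seq1. Qed.

Lemma lift_linear : linear (lift f).
Proof.
move=> a s t; rewrite -[s]tmkK -[t]tmkK tmkZE tmkDE !lift_tmk big_cat /=.
congr (_ + _); rewrite big_map scaler_sumr; apply: eq_bigr => p _.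
by rewrite fZl.
Qed.

End Lift.

Section LinearRules.
Variables (X U V W : lmodType k).

Lemma linear_zero_map (f : X -> W) : linear f -> f 0 = 0.
Proof.
move=> fl; have := fl 1 0 0; rewrite !scale1r addr0 => /esym e.
by apply: (addrI (f 0)); rewrite e addr0.
Qed.

Lemma linear_sum_map (f : X -> W) (I : Type) (r : seq I) (F : I -> X) :
  linear f -> f (\sum_(i <- r) F i) = \sum_(i <- r) f (F i).
Proof.
move=> fl; elim: r => [|i r IHr]; first by rewrite !big_nil linear_zero_map.
by rewrite !big_cons -IHr -[F i]scale1r fl !scale1r.
Qed.

Lemma lin_liftf (f : X -> U -> V -> W) (t : U \otimes V) :
  (forall u v, linear (fun x => f x u v)) -> linear (fun x => lift (f x) t).
Proof.
move=> fl a x y; rewrite /lift scaler_sumr -big_split /=.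
by apply: eq_bigr => p _; apply: fl.
Qed.

Lemma lin_lift (g : X -> U \otimes V) (f : U -> V -> W) :
  bilinear_map f -> linear g -> linear (fun x => lift f (g x)).
Proof. by move=> fb gl a x y; rewrite gl lift_linear. Qed.

Lemma lin_oxl (g : X -> U) (v : V) : linear g -> linear (fun x => g x \ox v).
Proof. by move=> gl a x y; rewrite gl (ptens_bilinear U V).1. Qed.

Lemma lin_oxr (g : X -> V) (u : U) : linear g -> linear (fun x => u \ox g x).
Proof. by move=> gl a x y; rewrite gl (ptens_bilinear U V).2. Qed.

Lemma lin_comp (f : {linear U -> W}) (g : X -> U) :
  linear g -> linear (fun x => f (g x)).
Proof. by move=> gl a x y; rewrite gl linearP. Qed.

Lemma lin_scalel (f : {scalar U}) (g : X -> U) (w : W) :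
  linear g -> linear (fun x => f (g x) *: w).
Proof. by move=> gl a x y; rewrite gl linearP /= scalerDl scalerA. Qed.

Lemma lin_scaler (g : X -> W) (b : k) :
  linear g -> linear (fun x => b *: g x).
Proof. by move=> gl a x y; rewrite gl scalerDr !scalerA mulrC. Qed.

Lemma lin_id : linear (fun x : X => x).
Proof. by []. Qed.

End LinearRules.

Lemma liftP U V W (f : U -> V -> W) (g : U \otimes V -> W) :
  bilinear_map f -> linear g -> (forall u v, g (u \ox v) = f u v) ->
  g =1 lift f.
Proof.
move=> fb gl gE t; rewrite {1}[t]tensE linear_sum_map // /lift.
by apply: eq_bigr => p _.
Qed.

Lemma tens_ext U V W (g h : U \otimes V -> W) :
  linear g -> linear h -> (forall u v, g (u \ox v) = h (u \ox v)) -> g =1 h.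
Proof.
move=> gl hl gh t; rewrite [t]tensE !linear_sum_map //.
by apply: eq_bigr => p _.
Qed.

Lemma lift_swap U V U' V' W (f : U -> V -> U' -> V' -> W)
    (s : U \otimes V) (t : U' \otimes V') :
  lift (fun u v => lift (f u v) t) s =
  lift (fun u' v' => lift (fun u v => f u v u' v') s) t.
Proof. by rewrite /lift exchange_big. Qed.

Lemma eq_lift U V W (f g : U -> V -> W) (t : U \otimes V) :
  (forall u v, f u v = g u v) -> lift f t = lift g t.
Proof. by move=> fg; apply: eq_bigr => p _. Qed.

End TensorTheory.

Ltac lin := cbv beta; lazymatch goal with
  | |- bilinear_map _ => split; lin
  | |- forall _, _ => intro; lin
  | |- _ => first
    [ assumption | exact: lin_id
    | apply: lin_oxl; lin | apply: lin_oxr; lin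
    | apply: lin_scaler; lin | apply: lin_scalel; lin
    | apply: lin_liftf; lin | apply: lin_lift; lin | apply: lin_comp; lin
    | idtac ]
  end.

HB.mixin Record Lmodule_isCoalgebra (k : fieldType) C of GRing.Lmodule k C := {
  comul : {linear C -> C \otimes C};
  counit : {scalar C};
  (* (id \otimes comul) \o comul = (comul \otimes id) \o comul, after
     reassociation *)
  comulA : forall x,
    lift (fun a b => lift (fun b1 b2 => a \ox (b1 \ox b2)) (comul b)) (comul x) =
    lift (fun a b => lift (fun a1 a2 => a1 \ox (a2 \ox b)) (comul a)) (comul x)
      :> C \otimes (C \otimes C);
  counitl : forall x, lift (fun a b => counit a *: b) (comul x) = x;
  counitr : forall x, lift (fun a b => counit b *: a) (comul x) = x
}.

#[short(type="coalgType")]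
HB.structure Definition Coalgebra (k : fieldType) :=
  { C of Lmodule_isCoalgebra k C & GRing.Lmodule k C }.

Section Sweedler.
Variables (k : fieldType) (C : coalgType k) (W : lmodType k).

(* Sweedler notation: the sum of the f x_(1) ... x_(n); the argument f is
   always multilinear.  The last leg is the one which is split further. *)
Definition sweedler2 (x : C) (f : C -> C -> W) : W := lift f (comul x).

Definition sweedler3 (x : C) (f : C -> C -> C -> W) : W :=
  sweedler2 x (fun x1 y => sweedler2 y (fun x2 x3 => f x1 x2 x3)).

Definition sweedler4 (x : C) (f : C -> C -> C -> C -> W) : W :=
  sweedler3 x (fun x1 x2 y => sweedler2 y (fun x3 x4 => f x1 x2 x3 x4)).

End Sweedler.

Notation "\sw[ a , b <- x ] F" := (sweedler2 x (fun a b => F))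
  (at level 36, a name, b name, x at level 34, F at level 50,
   format "\sw[ a ,  b  <-  x ]  F") : ring_scope.
Notation "\sw[ a , b , c <- x ] F" := (sweedler3 x (fun a b c => F))
  (at level 36, a name, b name, c name, x at level 34, F at level 50,
   format "\sw[ a ,  b ,  c  <-  x ]  F") : ring_scope.
Notation "\sw[ a , b , c , d <- x ] F" := (sweedler4 x (fun a b c d => F))
  (at level 36, a name, b name, c name, d name, x at level 34, F at level 50,
   format "\sw[ a ,  b ,  c ,  d  <-  x ]  F") : ring_scope.

Ltac swlin := rewrite /sweedler4 /sweedler3 /sweedler2; lin.

Section CoalgebraTheory.
Variables (k : fieldType).
Implicit Types C D : coalgType k.

Lemma lift_fuse (U V W X : lmodType k) (g : U -> V -> X) (f : X -> W)
    (t : U \otimes V) :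
  linear f -> f (lift g t) = lift (fun u v => f (g u v)) t.
Proof. by move=> fl; rewrite /lift linear_sum_map. Qed.

Lemma sw_coassoc C (W : lmodType k) (f : C -> C -> C -> W) (x : C) :
  (forall b c, linear (fun a => f a b c)) ->
  (forall a c, linear (fun b => f a b c)) ->
  (forall a b, linear (fun c => f a b c)) ->
  \sw[a, b <- x] \sw[a1, a2 <- a] f a1 a2 b =
  \sw[a, b <- x] \sw[b1, b2 <- b] f a b1 b2.
Proof.
move=> f1 f2 f3.
pose g (t : C \otimes (C \otimes C)) := lift (fun a s => lift (f a) s) t.
have gl : linear g by rewrite /g; lin; do ?[exact: f1 | exact: f2 | exact: f3].
have := congr1 g (comulA x); rewrite !(lift_fuse _ _ gl) /sweedler2 => e.
apply: etrans (etrans (esym e) _); last first.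
  apply: eq_lift => a b; rewrite (lift_fuse _ _ gl); apply: eq_lift => b1 b2.
  rewrite /g liftE; last by lin; do ?[exact: f1 | exact: f2 | exact: f3].
  by rewrite liftE //; lin; do ?[exact: f1 | exact: f2 | exact: f3].
apply: eq_lift => a b; rewrite (lift_fuse _ _ gl); apply: eq_lift => a1 a2.
rewrite /g liftE; last by lin; do ?[exact: f1 | exact: f2 | exact: f3].
by rewrite liftE //; lin; do ?[exact: f1 | exact: f2 | exact: f3].
Qed.

Definition coalgebra_map C D (f : C -> D) : Prop :=
  [/\ linear f,
      forall x, comul (f x) = \sw[x1, x2 <- x] f x1 \ox f x2
    & forall x, counit (f x) = counit x].

Definition grouplike C (g : C) : Prop :=
  comul g = g \ox g /\ counit g = 1.

End CoalgebraTheory.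

Section TensorCoalgebra.
Variables (k : fieldType) (C D : coalgType k).

Definition tens_comul (t : C \otimes D) : (C \otimes D) \otimes (C \otimes D) :=
  lift (fun c d => \sw[c1, c2 <- c] \sw[d1, d2 <- d]
                     (c1 \ox d1) \ox (c2 \ox d2)) t.

Definition tens_counit (t : C \otimes D) : k^o :=
  @lift k C D k^o (fun c d => counit c * counit d) t.

Lemma tens_comul_bilinear :
  bilinear_map (fun (c : C) (d : D) => \sw[c1, c2 <- c] \sw[d1, d2 <- d]
                     (c1 \ox d1) \ox (c2 \ox d2)).
Proof. by swlin. Qed.

Lemma tens_comul_linear : linear tens_comul.
Proof. exact: lift_linear tens_comul_bilinear. Qed.

HB.instance Definition _ := GRing.isLinear.Build k _ _ _ tens_comul
  tens_comul_linear.

Lemma tens_counit_bilinear :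
  @bilinear_map k C D k^o (fun c d => counit c * counit d).
Proof.
split=> [d a x y|c a x y]; rewrite linearP /=.
  by rewrite mulrDl -mulrA.
by rewrite mulrDr mulrCA.
Qed.

Lemma tens_counit_scalar : scalar tens_counit.
Proof. exact: lift_linear tens_counit_bilinear. Qed.

HB.instance Definition _ := GRing.isLinear.Build k _ _ _ tens_counit
  tens_counit_scalar.

Lemma tens_comulE c d : tens_comul (c \ox d) =
  \sw[c1, c2 <- c] \sw[d1, d2 <- d] (c1 \ox d1) \ox (c2 \ox d2).
Proof. exact: liftE tens_comul_bilinear _ _. Qed.

Lemma tens_counitE c d : tens_counit (c \ox d) = counit c * counit d.
Proof. exact: liftE tens_counit_bilinear _ _. Qed.

Lemma lift_tens_comul (W : lmodType k) (f : C \otimes D -> C \otimes D -> W) c d :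
  bilinear_map f ->
  lift f (tens_comul (c \ox d)) =
  \sw[c1, c2 <- c] \sw[d1, d2 <- d] f (c1 \ox d1) (c2 \ox d2).
Proof.
move=> fb; rewrite tens_comulE /sweedler2.
rewrite (lift_fuse _ _ (lift_linear fb)); apply: eq_lift => c1 c2.
rewrite (lift_fuse _ _ (lift_linear fb)); apply: eq_lift => d1 d2.
exact: liftE.
Qed.

Lemma tens_comulA (t : C \otimes D) :
  lift (fun a b => lift (fun b1 b2 => a \ox (b1 \ox b2)) (tens_comul b))
    (tens_comul t) =
  lift (fun a b => lift (fun a1 a2 => a1 \ox (a2 \ox b)) (tens_comul a))
    (tens_comul t).
Proof.
have tl := tens_comul_linear.
move: t; apply: tens_ext => [||c d].
- by apply: lin_lift => //; lin.
- by apply: lin_lift => //; lin.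
rewrite lift_tens_comul; last by lin.
rewrite lift_tens_comul; last by lin.
transitivity (\sw[c1, c2 <- c] \sw[c21, c22 <- c2]
   \sw[d1, d2 <- d] \sw[d21, d22 <- d2]
   (c1 \ox d1) \ox ((c21 \ox d21) \ox (c22 \ox d22))).
  apply: eq_lift => c1 c2; rewrite [RHS]lift_swap; apply: eq_lift => d1 d2.
  by rewrite lift_tens_comul //; lin.
rewrite -(@sw_coassoc _ C _ (fun c1 c21 c22 => \sw[d1, d2 <- d] \sw[d21, d22 <- d2]
   (c1 \ox d1) \ox ((c21 \ox d21) \ox (c22 \ox d22)))); try by swlin.
apply: eq_lift => c1 c2.
transitivity (\sw[d1, d2 <- d] \sw[c11, c12 <- c1] \sw[d11, d12 <- d1]
   (c11 \ox d11) \ox ((c12 \ox d12) \ox (c2 \ox d2))).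
  rewrite [RHS]lift_swap; apply: eq_lift => c11 c12.
  rewrite -(@sw_coassoc _ D _ (fun d1 d21 d22 =>
    (c11 \ox d1) \ox ((c12 \ox d21) \ox (c2 \ox d22)))) //; by swlin.
apply: eq_lift => d1 d2.
by rewrite lift_tens_comul //; lin.
Qed.

Lemma ptensZ (a b : k) (c : C) (d : D) :
  (a *: c) \ox (b *: d) = (a * b) *: (c \ox d).
Proof.
have bl := ptens_bilinear C D.
have Zl (r : k) (u : C) (v : D) : (r *: u) \ox v = r *: (u \ox v).
  by have := bl.1 v r u 0; rewrite (linear_zero_map (bl.1 v)) !addr0.
have Zr (r : k) (u : C) (v : D) : u \ox (r *: v) = r *: (u \ox v).
  by have := bl.2 u r v 0; rewrite (linear_zero_map (bl.2 u)) !addr0.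
by rewrite Zl Zr scalerA.
Qed.

Lemma tens_counitl (t : C \otimes D) :
  lift (fun a b => tens_counit a *: b) (tens_comul t) = t.
Proof.
have tl := tens_comul_linear.
move: t; apply: tens_ext => [||c d]; [by lin|by lin|].
rewrite lift_tens_comul; last by lin.
rewrite -{2}[c]counitl -{2}[d]counitl.
rewrite (@lift_fuse _ _ _ _ _ _ (fun x => x \ox _)); last by lin.
apply: eq_lift => c1 c2.
rewrite (@lift_fuse _ _ _ _ _ _ (fun x => _ \ox x)); last by lin.
by apply: eq_lift => d1 d2; rewrite tens_counitE ptensZ.
Qed.

Lemma tens_counitr (t : C \otimes D) :
  lift (fun a b => tens_counit b *: a) (tens_comul t) = t.
Proof.
have tl := tens_comul_linear.
move: t; apply: tens_ext => [||c d]; [by lin|by lin|].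
rewrite lift_tens_comul; last by lin.
rewrite -{2}[c]counitr -{2}[d]counitr.
rewrite (@lift_fuse _ _ _ _ _ _ (fun x => x \ox _)); last by lin.
apply: eq_lift => c1 c2.
rewrite (@lift_fuse _ _ _ _ _ _ (fun x => _ \ox x)); last by lin.
by apply: eq_lift => d1 d2; rewrite tens_counitE ptensZ.
Qed.

HB.instance Definition _ := Lmodule_isCoalgebra.Build k (C \otimes D)
  tens_comulA tens_counitl tens_counitr.

Lemma comul_ptens (c : C) (d : D) : comul (c \ox d) =
  \sw[c1, c2 <- c] \sw[d1, d2 <- d] (c1 \ox d1) \ox (c2 \ox d2).
Proof. exact: tens_comulE. Qed.

Lemma counit_ptens (c : C) (d : D) : counit (c \ox d) = counit c * counit d.
Proof. exact: tens_counitE. Qed.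

End TensorCoalgebra.

Record is_bialgebra (k : fieldType) (A : coalgType k) (mul : A -> A -> A)
    (one : A) : Prop := IsBialgebra {
  bialg_bilinear : bilinear_map mul;
  bialg_mulA : associative mul;
  bialg_mul1r : left_id one mul;
  bialg_mulr1 : right_id one mul;
  bialg_comulM : forall a b,
    comul (mul a b) = \sw[a1, a2 <- a] \sw[b1, b2 <- b]
                        mul a1 b1 \ox mul a2 b2;
  bialg_comul1 : comul one = one \ox one;
  bialg_counitM : forall a b, counit (mul a b) = counit a * counit b;
  bialg_counit1 : counit one = 1
}.

Record bicocycle_pair (k : fieldType) (M H : coalgType k) := BicocyclePair {
  bp_e : M;
  bp_one : H;
  bp_varphi : {linear H \otimes M -> M};
  bp_psi : {linear H \otimes M -> H};
  bp_phi : {linear M \otimes M -> M};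
  bp_theta : {linear M \otimes M -> H};
  bp_mu : {linear H \otimes H -> H};
  bp_gamma : {linear H \otimes H -> M};
  bp_e_grouplike : grouplike bp_e;
  bp_one_grouplike : grouplike bp_one;
  bp_varphi_coalg : coalgebra_map bp_varphi;
  bp_psi_coalg : coalgebra_map bp_psi;
  bp_phi_coalg : coalgebra_map bp_phi;
  bp_theta_coalg : coalgebra_map bp_theta;
  bp_mu_coalg : coalgebra_map bp_mu;
  bp_gamma_coalg : coalgebra_map bp_gamma;
  bp_varphi_one : forall x, bp_varphi (bp_one \ox x) = x;
  bp_psi_e : forall h, bp_psi (h \ox bp_e) = h;
  bp_varphi_e : forall h, bp_varphi (h \ox bp_e) = counit h *: bp_e;
  bp_psi_one : forall x, bp_psi (bp_one \ox x) = counit x *: bp_one;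
  bp_theta_ee : bp_theta (bp_e \ox bp_e) = bp_one;
  bp_mu_11 : bp_mu (bp_one \ox bp_one) = bp_one;
  bp_phi_ee : bp_phi (bp_e \ox bp_e) = bp_e;
  bp_gamma_11 : bp_gamma (bp_one \ox bp_one) = bp_e
}.

Section Bicocycle.
Variables (k : fieldType) (M H : coalgType k) (P : bicocycle_pair M H).

Local Notation e := (bp_e P).
Local Notation one := (bp_one P).
Local Notation varphi h x := (bp_varphi P (h \ox x)).
Local Notation psi h x := (bp_psi P (h \ox x)).
Local Notation theta x x' := (bp_theta P (x \ox x')).
Local Notation gamma h h' := (bp_gamma P (h \ox h')).
Local Notation "x ** x'" := (bp_phi P (x \ox x'))
  (at level 30, no associativity).
Local Notation "h ## h'" := (bp_mu P (h \ox h'))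
  (at level 30, no associativity).

(* The linear extension of this formula is the multiplication, see
   bicocycle_mulE and bicocycle_mul_bilinear. *)
Definition bicocycle_mul_pure (x : M) (h : H) (x' : M) (h' : H) : M \otimes H :=
  \sw[x1, x2 <- x] \sw[h1, h2, h3, h4 <- h]
  \sw[x1', x2', x3', x4' <- x'] \sw[h1', h2' <- h']
    (x1 ** (varphi h1 x1' ** gamma (psi h2 x2') h1'))
    \ox ((theta x2 (varphi h3 x3') ## psi h4 x4') ## h2').

Definition bicocycle_mul (t t' : M \otimes H) : M \otimes H :=
  lift (fun x h => lift (fun x' h' => bicocycle_mul_pure x h x' h') t') t.

Lemma bicocycle_mulE x h x' h' :
  bicocycle_mul (x \ox h) (x' \ox h') =
  \sw[x1, x2 <- x] \sw[h1, h2, h3, h4 <- h]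
  \sw[x1', x2', x3', x4' <- x'] \sw[h1', h2' <- h']
    (x1 ** (varphi h1 x1' ** gamma (psi h2 x2') h1'))
    \ox ((theta x2 (varphi h3 x3') ## psi h4 x4') ## h2').
Proof.
rewrite /bicocycle_mul liftE; last by rewrite /bicocycle_mul_pure; swlin.
by rewrite liftE //; rewrite /bicocycle_mul_pure; swlin.
Qed.

Lemma bicocycle_mul_bilinear : bilinear_map bicocycle_mul.
Proof. by rewrite /bicocycle_mul /bicocycle_mul_pure; swlin. Qed.

Record bicocycle_conditions : Prop := BicocycleConditions {
  bc_cond1 : (forall x, e ** x = x /\ x ** e = x) /\
             (forall h, one ## h = h /\ h ## one = h);
  bc_cond2 :
    (forall x, theta x e = counit x *: one /\ theta e x = counit x *: one) /\
    (forall h, gamma h one = counit h *: e /\ gamma one h = counit h *: e);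
  bc_cond3 : forall h x' x'' h'',
    \sw[h1, h2 <- h] \sw[x1', x2', x3' <- x'] \sw[x1'', x2'', x3'' <- x'']
      (varphi h1 (x1' ** x1'') **
       gamma (psi h2 (x2' ** x2'')) (theta x3' x3'' ## h'')) =
    \sw[h1, h2, h3 <- h] \sw[x1', x2', x3' <- x'] \sw[x1'', x2'' <- x'']
      (varphi h1 x1' **
       (varphi (psi h2 x2') x1'' ** gamma (psi (psi h3 x3') x2'') h''));
  bc_cond4 : forall h x' x'' h'',
    \sw[x1', x2' <- x'] \sw[x1'', x2'' <- x'']
      (psi h (x1' ** x1'') ## (theta x2' x2'' ## h'')) =
    \sw[h1, h2, h3 <- h] \sw[x1', x2', x3' <- x'] \sw[x1'', x2'' <- x'']
      ((theta (varphi h1 x1') (varphi (psi h2 x2') x1'') ##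
        psi (psi h3 x3') x2'') ## h'');
  bc_cond5 : forall x h h' x'',
    \sw[h1, h2, h3 <- h] \sw[h1', h2', h3' <- h'] \sw[x1'', x2'' <- x'']
      (theta (x ** gamma h1 h1') (varphi (h2 ## h2') x1'') ##
       psi (h3 ## h3') x2'') =
    \sw[h1, h2 <- h] \sw[h1', h2', h3' <- h'] \sw[x1'', x2'', x3'' <- x'']
      ((theta x (varphi h1 (varphi h1' x1'')) ##
        psi h2 (varphi h2' x2'')) ## psi h3' x3'');
  bc_cond6 : forall x h h' x'',
    \sw[h1, h2 <- h] \sw[h1', h2' <- h']
      ((x ** gamma h1 h1') ** varphi (h2 ## h2') x'') =
    \sw[h1, h2 <- h] \sw[h1', h2', h3' <- h'] \sw[x1'', x2'', x3'' <- x'']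
      (x ** (varphi h1 (varphi h1' x1'') **
             gamma (psi h2 (varphi h2' x2'')) (psi h3' x3'')));
  bc_cond7 : forall x x' x'' h'',
    counit h'' *: (x ** (x' ** x'')) =
    \sw[x1, x2, x3 <- x] \sw[x1', x2', x3' <- x'] \sw[x1'', x2'' <- x'']
      ((x1 ** x1') **
       (varphi (theta x2 x2') x1'' ** gamma (psi (theta x3 x3') x2'') h''));
  bc_cond8 : forall x x' x'' h'',
    \sw[x1', x2' <- x'] \sw[x1'', x2'' <- x'']
      (theta x (x1' ** x1'') ## (theta x2' x2'' ## h'')) =
    \sw[x1, x2, x3 <- x] \sw[x1', x2', x3' <- x'] \sw[x1'', x2'' <- x'']
      ((theta (x1 ** x1') (varphi (theta x2 x2') x1'') ##
        psi (theta x3 x3') x2'') ## h'');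
  bc_cond9 : forall x h h' h'',
    \sw[h1, h2 <- h] \sw[h1', h2' <- h']
      ((x ** gamma h1 h1') ** gamma (h2 ## h2') h'') =
    \sw[h1, h2 <- h] \sw[h1', h2', h3' <- h'] \sw[h1'', h2'', h3'' <- h'']
      (x ** (varphi h1 (gamma h1' h1'') **
             gamma (psi h2 (gamma h2' h2'')) (h3' ## h3'')));
  bc_cond10 : forall x h h' h'',
    counit x *: ((h ## h') ## h'') =
    \sw[h1, h2 <- h] \sw[h1', h2', h3' <- h'] \sw[h1'', h2'', h3'' <- h'']
      ((theta x (varphi h1 (gamma h1' h1'')) ##
        psi h2 (gamma h2' h2'')) ## (h3' ## h3''));
  bc_cond11 : forall h x,
    \sw[h1, h2 <- h] \sw[x1, x2 <- x] psi h2 x2 \ox varphi h1 x1 =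
    \sw[h1, h2 <- h] \sw[x1, x2 <- x] psi h1 x1 \ox varphi h2 x2;
  bc_cond12 : forall x x',
    \sw[x1, x2 <- x] \sw[x1', x2' <- x'] theta x2 x2' \ox (x1 ** x1') =
    \sw[x1, x2 <- x] \sw[x1', x2' <- x'] theta x1 x1' \ox (x2 ** x2');
  bc_cond13 : forall h h',
    \sw[h1, h2 <- h] \sw[h1', h2' <- h'] (h2 ## h2') \ox gamma h1 h1' =
    \sw[h1, h2 <- h] \sw[h1', h2' <- h'] (h1 ## h1') \ox gamma h2 h2'
}.

End Bicocycle.

(* Main.v *)
(** Write [G] for [M \otimes H] and [pi_M], [pi_H] for its projections. The
    product [mul a b] is the sum of the [mull a1 b1 \ox mulr a2 b2], where
    [mull = pi_M \o mul] and [mulr = pi_H \o mul]. Conditions 3-10 are the two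
    components of associativity on the triples (h, x', g''), (g, h', x''),
    (x, x', g'') and (g, h', h''), and 11-13 come from the fact that
    [pi_M c1 \ox pi_H c2] is symmetric under exchanging the legs of any
    comultiplication. This gives the forward direction.

    Conversely, 11 makes [h \ox x |-> varphi h1 x1 \ox psi h2 x2] a coalgebra
    map. Compatibility of [mul] with [comul] then amounts to the commutation of
    [x ** (y ** gamma l h')] and [(theta x y ## l) ## h']. Condition 7 rewrites
    the former as [(x1 ** y1) ** varphi (theta x2 y2) (gamma l h')], and 10
    rewrites the latter as [psi (theta x y) (gamma l1 h1') ## (l2 ## h2')]; in
    this form 11, 12 and 13 apply. Once [mul] is a coalgebra map, each of the
    four families of triples is associative, because coalgebra maps into [G]
    are determined by their projections. Associativity then extends to all of
    [G] by writing elements as products [x * h]. The triples (x, h, g) are not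
    covered by the conditions: [x * (h * (x' * h')) = ((x * h) * x') * h'] can
    be derived, and [(x * h) * (x' * h')] shares one projection with each
    side. *)

From HB Require Import structures.
From mathcomp Require Import all_boot all_order all_algebra ring.
Require Import Defs.
Set Implicit Arguments.
Unset Strict Implicit.
Unset Printing Implicit Defensive.
Import GRing.Theory.
Local Open Scope ring_scope.

(** * Sweedler calculus *)

Section SweedlerCalculus.
Variable k : fieldType.
Implicit Types (U V W X Y : lmodType k) (C D E : coalgType k).

Lemma linear_lift U V X W (f : {linear X -> W}) (g : U -> V -> X)
    (t : U \otimes V) :
  f (lift g t) = lift (fun u v => f (g u v)) t.
Proof. exact: (lift_fuse g t (linearP f)). Qed.

(** A functional takes values in [k], so the sum on the right is formed explicitly in the module
    [k^o]. *)
Lemma scalar_lift U V X (f : {scalar X}) (g : U -> V -> X)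
    (t : U \otimes V) :
  f (lift g t) = @lift k U V k^o (fun u v => f (g u v)) t.
Proof. exact: (@lift_fuse k U V k^o X g f t (linearP f)). Qed.

Lemma ox_liftl U V X W (g : U -> V -> X) (t : U \otimes V) (w : W) :
  lift g t \ox w = lift (fun u v => g u v \ox w) t.
Proof. exact: (lift_fuse g t ((ptens_bilinear X W).1 w)). Qed.

Lemma ox_liftr U V X W (g : U -> V -> X) (t : U \otimes V) (w : W) :
  w \ox lift g t = lift (fun u v => w \ox g u v) t.
Proof. exact: (lift_fuse g t ((ptens_bilinear W X).2 w)). Qed.

Lemma scaler_lift U V W (a : k) (g : U -> V -> W) (t : U \otimes V) :
  a *: lift g t = lift (fun u v => a *: g u v) t.
Proof. by rewrite /lift scaler_sumr. Qed.

Lemma lift_lift U V X Y W (f : X -> Y -> W) (g : U -> V -> X \otimes Y)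
    (t : U \otimes V) :
  bilinear_map f -> lift f (lift g t) = lift (fun u v => lift f (g u v)) t.
Proof. by move=> fb; apply: lift_fuse; apply: lift_linear. Qed.

Lemma ptensZl U V (a : k) (u : U) (v : V) : (a *: u) \ox v = a *: (u \ox v).
Proof.
have bl := (ptens_bilinear U V).1 v.
by have := bl a u 0; rewrite (linear_zero_map bl) !addr0.
Qed.

Lemma ptensZr U V (a : k) (u : U) (v : V) : u \ox (a *: v) = a *: (u \ox v).
Proof.
have bl := (ptens_bilinear U V).2 u.
by have := bl a v 0; rewrite (linear_zero_map bl) !addr0.
Qed.

Lemma sw_coalgebra_map C D W (F : C -> D) (f : D -> D -> W) (c : C) :
  coalgebra_map F -> bilinear_map f ->
  lift f (comul (F c)) = lift (fun c1 c2 => f (F c1) (F c2)) (comul c).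
Proof.
case=> _ -> _ fb; rewrite /sweedler2 lift_lift //.
by apply: eq_lift => c1 c2; rewrite liftE.
Qed.

Lemma sw_ox C D W (f : C \otimes D -> C \otimes D -> W) c d :
  bilinear_map f -> lift f (comul (c \ox d)) =
  lift (fun c1 c2 => lift (fun d1 d2 => f (c1 \ox d1) (c2 \ox d2)) (comul d))
    (comul c).
Proof. exact: lift_tens_comul. Qed.

Lemma sw_coalgebra_map_ox C D E W (F : {linear C \otimes D -> E})
    (f : E -> E -> W) (c : C) (d : D) :
  coalgebra_map F -> bilinear_map f ->
  lift f (comul (F (c \ox d))) =
  lift (fun c1 c2 => lift (fun d1 d2 => f (F (c1 \ox d1)) (F (c2 \ox d2)))
    (comul d)) (comul c).
Proof.
move=> Fc fb; rewrite sw_coalgebra_map // sw_ox //.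
by split=> [v|u] a x y; rewrite linearP; [apply: fb.1 | apply: fb.2].
Qed.

Lemma lift_coassoc C W (f : C -> C -> C -> W) (x : C) :
  (forall b c, linear (fun a => f a b c)) ->
  (forall a c, linear (fun b => f a b c)) ->
  (forall a b, linear (fun c => f a b c)) ->
  lift (fun a b => lift (fun a1 a2 => f a1 a2 b) (comul a)) (comul x) =
  lift (fun a b => lift (fun b1 b2 => f a b1 b2) (comul b)) (comul x).
Proof. exact: sw_coassoc. Qed.

Lemma sw_counitl C W (f : C -> W) (x : C) : linear f ->
  lift (fun a b => counit a *: f b) (comul x) = f x.
Proof.
move=> fl; rewrite -[in RHS](counitl x) lift_fuse //; apply: eq_lift => a b.
by have := fl (counit a) b 0; rewrite (linear_zero_map fl) !addr0.
Qed.

Lemma sw_counitr C W (f : C -> W) (x : C) : linear f ->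
  lift (fun a b => counit b *: f a) (comul x) = f x.
Proof.
move=> fl; rewrite -[in RHS](counitr x) lift_fuse //; apply: eq_lift => a b.
by have := fl (counit b) a 0; rewrite (linear_zero_map fl) !addr0.
Qed.

End SweedlerCalculus.

(* [sw_match] proves the equality of two iterated Sweedler sums, up to the order
   of the summations and coassociativity: [sw_pull x] moves the comultiplication
   of [x] to the front, and [sw_rassoc] turns splittings of the first leg into
   splittings of the second one. *)
Ltac sw_pull x := cbv beta; lazymatch goal with
  | |- lift _ (_ x) = _ => reflexivity
  | |- lift _ _ = _ => eapply eq_trans;
      [eapply eq_lift; intros ? ?; sw_pull x | eapply lift_swap]
  end.

Ltac sw_rassoc := cbv beta; lazymatch goal with
  | |- lift _ (_ ?y) = _ =>
    tryif (eapply eq_trans;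
      [eapply eq_lift; let a := fresh "a" in let b := fresh "b" in
       intros a b; sw_pull a | ])
    then (eapply eq_trans; [eapply lift_coassoc; lin | sw_rassoc])
    else reflexivity
  end.

Ltac sw_match := cbv beta; lazymatch goal with
  | |- lift _ (_ ?y) = _ =>
    eapply eq_trans; [sw_rassoc | ]; apply: esym;
    eapply eq_trans; [sw_pull y | ];
    eapply eq_trans; [sw_rassoc | ]; apply: esym;
    apply: eq_lift => ? ?; sw_match
  | |- _ => try reflexivity
  end.

(** * Coalgebra maps into a tensor product *)

Section Projections.
Variables (k : fieldType) (C D : coalgType k).

(** [prl] and [prr] are [id \otimes counit] and [counit \otimes id]; on [M \otimes H] they are
    [pi_M] and [pi_H]. *)
Definition prl (t : C \otimes D) : C := lift (fun c d => counit d *: c) t.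
Definition prr (t : C \otimes D) : D := lift (fun c d => counit c *: d) t.

Lemma prl_linear : linear prl. Proof. by apply: lift_linear; lin. Qed.
Lemma prr_linear : linear prr. Proof. by apply: lift_linear; lin. Qed.

HB.instance Definition _ := GRing.isLinear.Build k _ _ _ prl prl_linear.
HB.instance Definition _ := GRing.isLinear.Build k _ _ _ prr prr_linear.

Lemma prlE c d : prl (c \ox d) = counit d *: c.
Proof. by rewrite /prl liftE //; lin. Qed.

Lemma prrE c d : prr (c \ox d) = counit c *: d.
Proof. by rewrite /prr liftE //; lin. Qed.

Lemma prl_lift (U V : lmodType k) (g : U -> V -> C \otimes D) t :
  prl (lift g t) = lift (fun u v => prl (g u v)) t.
Proof. exact: linear_lift. Qed.

Lemma prr_lift (U V : lmodType k) (g : U -> V -> C \otimes D) t :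
  prr (lift g t) = lift (fun u v => prr (g u v)) t.
Proof. exact: linear_lift. Qed.

(** On [c \ox d] the counits fall on [d1] and [c2], and the counit laws remove these legs.
    Consequently a coalgebra map into [C \otimes D] is determined by its two projections. *)
Lemma prl_ox_prr (t : C \otimes D) :
  lift (fun t1 t2 => prl t1 \ox prr t2) (comul t) = t.
Proof.
move: t; apply: tens_ext => [||c d]; [by lin | by lin | ].
rewrite sw_ox; last by lin.
under eq_lift => c1 c2.
  under eq_lift => d1 d2 do
    rewrite prlE prrE ptensZr ptensZl scalerA mulrC -scalerA.
  rewrite sw_counitl; last by lin.
  over.
by rewrite sw_counitr //; lin.
Qed.

(** On [c \ox d] both sides collapse to [d \ox c]. This symmetry is the source of conditions
    11-13. *)
Lemma prl_prr_swap (t : C \otimes D) :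
  lift (fun t1 t2 => prr t1 \ox prl t2) (comul t) =
  lift (fun t1 t2 => prr t2 \ox prl t1) (comul t).
Proof.
move: t; apply: tens_ext => [||c d]; [by lin | by lin | ].
rewrite !sw_ox; try by lin.
transitivity (d \ox c).
  under eq_lift => c1 c2.
    under eq_lift => d1 d2 do rewrite prlE prrE ptensZr ptensZl.
    rewrite sw_counitr; last by lin.
    over.
  by rewrite sw_counitl //; lin.
apply: esym.
under eq_lift => c1 c2.
  under eq_lift => d1 d2 do rewrite prlE prrE ptensZr ptensZl.
  rewrite sw_counitl; last by lin.
  over.
by rewrite sw_counitr //; lin.
Qed.

End Projections.

Section Convolution.
Variables (k : fieldType) (C M H : coalgType k).
Variables (f : {linear C -> M}) (g : {linear C -> H}).

(** Conditions 11-13 assert this for the pairs ([varphi], [psi]), ([phi], [theta]) and ([gamma],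
    [mu]). *)
Definition cocommute :=
  forall c, lift (fun c1 c2 => g c2 \ox f c1) (comul c) =
            lift (fun c1 c2 => g c1 \ox f c2) (comul c).

(** By [prl_ox_prr], this is the only candidate for a coalgebra map with projections [f] and [g]. *)
Definition conv (c : C) : M \otimes H :=
  lift (fun c1 c2 => f c1 \ox g c2) (comul c).

Lemma conv_linear : linear conv.
Proof. by rewrite /conv; lin. Qed.

HB.instance Definition _ := GRing.isLinear.Build k _ _ _ conv conv_linear.

Lemma cocommute_lift (W : lmodType k) (K : H -> M -> W) c :
  cocommute -> bilinear_map K ->
  lift (fun c1 c2 => K (g c2) (f c1)) (comul c) =
  lift (fun c1 c2 => K (g c1) (f c2)) (comul c).
Proof.
move=> fg Kb; have := congr1 (lift K) (fg c); rewrite !lift_lift //.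
under eq_lift => c1 c2 do rewrite liftE //.
by under [in RHS]eq_lift => c1 c2 do rewrite liftE //.
Qed.

Lemma conv_coalgebra_map :
  coalgebra_map f -> coalgebra_map g -> cocommute -> coalgebra_map conv.
Proof.
move=> [_ fC fe] [_ gC ge] fg; split=> [|c|c]; first exact: conv_linear.
  rewrite /conv linear_lift.
  (* Comultiplying [f c1] and [g c2] separately distributes the legs as 1,3 and 2,4, whereas 1,2 and
     3,4 is wanted. The middle legs are isolated as the coproduct of [s], where [cocommute]
     exchanges them. *)
  transitivity (\sw[c1, r <- c] \sw[s, c4 <- r] \sw[c2, c3 <- s]
      (f c1 \ox g c3) \ox (f c2 \ox g c4)).
    under eq_lift => c1 c2.
      rewrite comul_ptens /sweedler2 fC gC /sweedler2 lift_lift; last by lin.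
      under eq_lift => a1 a2.
        rewrite liftE; last by lin.
        rewrite lift_lift; last by lin.
        under eq_lift => b1 b2.
          rewrite liftE; last by lin.
          over.
        over.
      over.
    rewrite /sweedler2; sw_match.
  transitivity (\sw[c1, r <- c] \sw[s, c4 <- r] \sw[c2, c3 <- s]
      (f c1 \ox g c2) \ox (f c3 \ox g c4)).
    rewrite /sweedler2; apply: eq_lift => c1 r. apply: eq_lift => s c4.
    apply: (cocommute_lift
      (K := fun x y => (f c1 \ox x) \ox (y \ox g c4))) => //.
    by split=> [v|u]; lin.
  rewrite /sweedler2.
  under [RHS]eq_lift => c1 c2.
    rewrite ox_liftl; under eq_lift => a1 a2 do rewrite ox_liftr; over.
  sw_match.
rewrite /conv scalar_lift.
under eq_lift => c1 c2 do rewrite counit_ptens fe ge.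
by rewrite (@sw_counitl _ C k^o (fun x => counit x)) //; exact: linearP.
Qed.

End Convolution.

(** * The two components of the product *)

Ltac pair_coalg := first [ assumption
  | exact: bp_varphi_coalg | exact: bp_psi_coalg | exact: bp_phi_coalg
  | exact: bp_theta_coalg | exact: bp_mu_coalg | exact: bp_gamma_coalg ].

(* Pushes the comultiplications through the structure maps, using [tac] to
   simplify the summands. *)
Ltac sw_expand tac := cbv beta;
  repeat first
    [ progress tac | rewrite ox_liftl | rewrite ox_liftr | rewrite linear_lift
    | lazymatch goal with
      | |- lift _ (lift _ _) = _ => rewrite lift_lift; [ | by lin]
      end ];
  lazymatch goal with
  | |- lift _ (_ (_ \ox _)) = _ =>
    eapply eq_trans; [eapply sw_ox; lin | sw_expand tac]
  | |- lift _ (_ (_ (_ \ox _))) = _ =>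
    eapply eq_trans;
      [eapply sw_coalgebra_map_ox; [pair_coalg | lin] | sw_expand tac]
  | |- lift _ (_ (GRing.Linear.sort _ _)) = _ =>
    eapply eq_trans;
      [eapply sw_coalgebra_map; [pair_coalg | lin] | sw_expand tac]
  | |- lift _ _ = _ => eapply eq_lift; intros ? ?; sw_expand tac
  | |- _ => reflexivity
  end.

Ltac sw_normalize tac :=
  rewrite /sweedler4 /sweedler3 /sweedler2;
  eapply eq_trans; [sw_expand tac | ]; apply: esym;
  eapply eq_trans; [sw_expand tac | ]; apply: esym; sw_match.

Section Pair.
Variables (k : fieldType) (M H : coalgType k) (P : bicocycle_pair M H).

Local Notation e := (bp_e P).
Local Notation one := (bp_one P).
Local Notation varphi h x := (bp_varphi P (h \ox x)).
Local Notation psi h x := (bp_psi P (h \ox x)).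
Local Notation theta x x' := (bp_theta P (x \ox x')).
Local Notation gamma h h' := (bp_gamma P (h \ox h')).
Local Notation "x ** x'" := (bp_phi P (x \ox x'))
  (at level 30, no associativity).
Local Notation "h ## h'" := (bp_mu P (h \ox h'))
  (at level 30, no associativity).
Local Notation mul := (bicocycle_mul P).

(** Under the unit conditions [mulQ h x' h'] is the M-component of the product of [e \ox h] and
    [x' \ox h'], and [mulR x h x'] is the H-component of the product of [x \ox h] and
    [x' \ox one]. *)
Definition mulQ (h : H) (x' : M) (h' : H) : M :=
  \sw[h1, h2 <- h] \sw[x1, x2 <- x'] (varphi h1 x1 ** gamma (psi h2 x2) h').

Definition mulR (x : M) (h : H) (x' : M) : H :=
  \sw[h1, h2 <- h] \sw[x1, x2 <- x'] (theta x (varphi h1 x1) ## psi h2 x2).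

Definition mull (a b : M \otimes H) : M :=
  lift (fun x h => lift (fun x' h' => x ** mulQ h x' h') b) a.

Definition mulr (a b : M \otimes H) : H :=
  lift (fun x h => lift (fun x' h' => mulR x h x' ## h') b) a.

Lemma mull_bilinear : bilinear_map mull.
Proof. by rewrite /mull /mulQ; swlin. Qed.

Lemma mulr_bilinear : bilinear_map mulr.
Proof. by rewrite /mulr /mulR; swlin. Qed.

Lemma mullE x h x' h' : mull (x \ox h) (x' \ox h') = x ** mulQ h x' h'.
Proof.
rewrite /mull liftE; last by rewrite /mulQ; swlin.
by rewrite liftE // /mulQ; swlin.
Qed.

Lemma mulrE x h x' h' : mulr (x \ox h) (x' \ox h') = mulR x h x' ## h'.
Proof.
rewrite /mulr liftE; last by rewrite /mulR; swlin.
by rewrite liftE // /mulR; swlin.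
Qed.

(** Of the four legs of [h] and of [x'] in the product formula, the first two enter only the
    M-factor and the last two only the H-factor, so coassociativity groups them as two
    coproducts. *)
Lemma mul_split a b :
  mul a b = lift (fun a1 a2 => lift (fun b1 b2 => mull a1 b1 \ox mulr a2 b2)
    (comul b)) (comul a).
Proof.
have [ml mr] := bicocycle_mul_bilinear P.
have [ll lr] := mull_bilinear; have [rl rr] := mulr_bilinear.
have bil v u : bilinear_map (fun b1 b2 => mull v b1 \ox mulr u b2).
  by split=> [w|w]; [apply: lin_oxl | apply: lin_oxr].
move: a; apply: tens_ext => [//||x h].
  apply: lin_lift; last exact: linearP.
  by split=> [v|u]; apply: lin_liftf => ? ?; [apply: lin_oxl | apply: lin_oxr].
move: b; apply: tens_ext => [//||x' h'].
  by apply: lin_liftf => u v; apply: lin_lift => //; exact: linearP.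
rewrite bicocycle_mulE sw_ox; last first.
  by split=> [v|u]; apply: lin_liftf => ? ?; [apply: lin_oxl | apply: lin_oxr].
under [RHS]eq_lift => x1 x2.
  under eq_lift => h1 h2.
    rewrite sw_ox //.
    under eq_lift => x1' x2' do under eq_lift => h1' h2' do
      rewrite mullE mulrE /mulQ /mulR.
    over.
  over.
sw_normalize idtac.
Qed.

Lemma sw_grouplike (C : coalgType k) (g : C) (W : lmodType k)
    (f : C -> C -> W) :
  grouplike g -> bilinear_map f -> lift f (comul g) = f g g.
Proof. by case=> -> _ fb; rewrite liftE. Qed.

Lemma counit_coalgebra_map_ox (C D E : coalgType k)
    (F : {linear C \otimes D -> E}) c d :
  coalgebra_map F -> counit (F (c \ox d)) = counit c * counit d.
Proof. by case=> _ _ ->; rewrite counit_ptens. Qed.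

Lemma counit_op :
  (forall h x, counit (varphi h x) = counit h * counit x) *
  (forall h x, counit (psi h x) = counit h * counit x) *
  (forall x x', counit (x ** x') = counit x * counit x') *
  (forall x x', counit (theta x x') = counit x * counit x') *
  (forall h h', counit (h ## h') = counit h * counit h') *
  (forall h h', counit (gamma h h') = counit h * counit h').
Proof. by do !split=> *; apply: counit_coalgebra_map_ox; pair_coalg. Qed.

Lemma sw_counit2 (C D : coalgType k) (W : lmodType k) (c : C) (d : D)
    (f : C -> D -> W) :
  bilinear_map f ->
  lift (fun c1 c2 => lift (fun d1 d2 =>
    (counit c2 * counit d2) *: f c1 d1) (comul d)) (comul c) = f c d.
Proof.
move=> fb.
under eq_lift => c1 c2.
  under eq_lift => d1 d2 do rewrite mulrC -scalerA.
  rewrite sw_counitr; last by apply: lin_scaler; apply: fb.2.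
  over.
by rewrite sw_counitr //; apply: fb.1.
Qed.

Lemma sw_counit2l (C D : coalgType k) (W : lmodType k) (c : C) (d : D)
    (f : C -> D -> W) :
  bilinear_map f ->
  lift (fun c1 c2 => lift (fun d1 d2 =>
    (counit c1 * counit d1) *: f c2 d2) (comul d)) (comul c) = f c d.
Proof.
move=> fb.
under eq_lift => c1 c2.
  under eq_lift => d1 d2 do rewrite mulrC -scalerA.
  rewrite sw_counitl; last by apply: lin_scaler; apply: fb.2.
  over.
by rewrite sw_counitl //; apply: fb.1.
Qed.

Lemma bilinear_counits (C D : coalgType k) (a : k) :
  @bilinear_map k C D k^o (fun c d => counit c * counit d * a).
Proof.
by split=> [d|c] b x y; rewrite linearP /GRing.scale /=; ring.
Qed.

Lemma counit_mulQ h x' h' :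
  counit (mulQ h x' h') = counit h * counit x' * counit h'.
Proof.
(* The right-hand side is blown up into a Sweedler sum so that the two sides can be compared summand
   by summand. *)
rewrite -(sw_counit2 h x' (bilinear_counits H M (counit h'))).
rewrite /mulQ /sweedler2 scalar_lift; apply: (@eq_lift _ _ _ k^o) => h1 h2.
rewrite scalar_lift; apply: (@eq_lift _ _ _ k^o) => x1 x2.
by rewrite !counit_op [RHS]/GRing.scale /=; ring.
Qed.

Lemma counit_mulR x h x' :
  counit (mulR x h x') = counit x * counit h * counit x'.
Proof.
have -> : counit x * counit h * counit x' = counit h * counit x' * counit x.
  by ring.
rewrite -(sw_counit2 h x' (bilinear_counits H M (counit x))).
rewrite /mulR /sweedler2 scalar_lift; apply: (@eq_lift _ _ _ k^o) => h1 h2.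
rewrite scalar_lift; apply: (@eq_lift _ _ _ k^o) => x1 x2.
by rewrite !counit_op [RHS]/GRing.scale /=; ring.
Qed.


Lemma counit_bilinear (C D E F B : coalgType k)
    (f : C \otimes D -> E \otimes F -> B) :
  bilinear_map f ->
  (forall c d e' f', counit (f (c \ox d) (e' \ox f')) =
    counit (c \ox d) * counit (e' \ox f')) ->
  forall a b, counit (f a b) = counit a * counit b.
Proof.
move=> [fl fr] fE a b.
move: a; apply: (tens_ext (W := k^o)) => [||c d].
- by move=> r x y; rewrite fl linearP.
- by move=> r x y; rewrite linearP /GRing.scale /=; ring.
move: b; apply: (tens_ext (W := k^o)) => [||e' f'] //.
- by move=> r x y; rewrite fr linearP.
- by move=> r x y; rewrite linearP /GRing.scale /=; ring.
Qed.

Lemma counit_mull a b : counit (mull a b) = counit a * counit b.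
Proof.
apply: counit_bilinear => [|x h x' h']; first exact: mull_bilinear.
by rewrite mullE !counit_op counit_mulQ !counit_ptens; ring.
Qed.

Lemma counit_mulr a b : counit (mulr a b) = counit a * counit b.
Proof.
apply: counit_bilinear => [|x h x' h']; first exact: mulr_bilinear.
by rewrite mulrE !counit_op counit_mulR !counit_ptens; ring.
Qed.

Lemma prl_mul a b : prl (mul a b) = mull a b.
Proof.
have [ll lr] := mull_bilinear.
rewrite mul_split prl_lift.
under eq_lift => a1 a2.
  rewrite prl_lift.
  under eq_lift => b1 b2 do rewrite prlE counit_mulr.
  over.
by rewrite sw_counit2 //; exact: mull_bilinear.
Qed.

Lemma prr_mul a b : prr (mul a b) = mulr a b.
Proof.
rewrite mul_split prr_lift.
under eq_lift => a1 a2.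
  rewrite prr_lift.
  under eq_lift => b1 b2 do rewrite prrE counit_mull.
  over.
by rewrite sw_counit2l //; exact: mulr_bilinear.
Qed.

Let e_g := bp_e_grouplike P.
Let one_g := bp_one_grouplike P.

(** This evaluation and the next three rest only on the normalizations in [bicocycle_pair], so they
    are available while the unit conditions are still being derived. *)
Lemma mulQ_one_l x' h' : mulQ one x' h' = x' ** gamma one h'.
Proof.
rewrite /mulQ /sweedler2 sw_grouplike //; last by swlin.
under eq_lift => x1 x2 do rewrite bp_varphi_one bp_psi_one ptensZl linearZ /=
  ptensZr linearZ /=.
by rewrite sw_counitr //; lin.
Qed.

Lemma mulQ_e h h' : mulQ h e h' = e ** gamma h h'.
Proof.
rewrite /mulQ /sweedler2.
under eq_lift => h1 h2.
  rewrite sw_grouplike //; last by lin.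
  rewrite bp_varphi_e bp_psi_e ptensZl linearZ /=.
  over.
by rewrite sw_counitl //; lin.
Qed.

Lemma mulR_one x x' : mulR x one x' = theta x x' ## one.
Proof.
rewrite /mulR /sweedler2 sw_grouplike //; last by swlin.
under eq_lift => x1 x2 do rewrite bp_varphi_one bp_psi_one ptensZr linearZ /=.
by rewrite (@sw_counitr _ _ _ (fun x1 => theta x x1 ## one)) //; lin.
Qed.

Lemma mulR_e x h : mulR x h e = theta x e ## h.
Proof.
rewrite /mulR /sweedler2.
under eq_lift => h1 h2.
  rewrite sw_grouplike //; last by lin.
  rewrite bp_varphi_e bp_psi_e ptensZr linearZ /= ptensZl linearZ /=.
  over.
by rewrite sw_counitl //; lin.
Qed.

Lemma sw_ox_one (W : lmodType k) (f : M \otimes H -> M \otimes H -> W) x :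
  bilinear_map f -> lift f (comul (x \ox one)) =
  lift (fun x1 x2 => f (x1 \ox one) (x2 \ox one)) (comul x).
Proof.
move=> fb; rewrite sw_ox //; apply: eq_lift => x1 x2.
rewrite sw_grouplike //.
split=> [v|u] a y z; rewrite (ptens_bilinear M H).2.
  exact: fb.1.
exact: fb.2.
Qed.

Lemma sw_e_ox (W : lmodType k) (f : M \otimes H -> M \otimes H -> W) h :
  bilinear_map f -> lift f (comul (e \ox h)) =
  lift (fun h1 h2 => f (e \ox h1) (e \ox h2)) (comul h).
Proof.
move=> fb; rewrite sw_ox // sw_grouplike //.
split=> [v|u]; apply: lin_liftf => h1 h2 a y z; rewrite (ptens_bilinear M H).1.
  exact: fb.1.
exact: fb.2.
Qed.

Lemma mull_liftl (V W : lmodType k) (g : V -> W -> M \otimes H) t b :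
  mull (lift g t) b = lift (fun u v => mull (g u v) b) t.
Proof.
by apply: (@lift_fuse _ _ _ _ _ g (mull^~ b)); apply: mull_bilinear.1.
Qed.

Lemma mull_liftr (V W : lmodType k) (g : V -> W -> M \otimes H) t a :
  mull a (lift g t) = lift (fun u v => mull a (g u v)) t.
Proof. by apply: lift_fuse; apply: mull_bilinear.2. Qed.

Lemma mulr_liftl (V W : lmodType k) (g : V -> W -> M \otimes H) t b :
  mulr (lift g t) b = lift (fun u v => mulr (g u v) b) t.
Proof.
by apply: (@lift_fuse _ _ _ _ _ g (mulr^~ b)); apply: mulr_bilinear.1.
Qed.

Lemma mulr_liftr (V W : lmodType k) (g : V -> W -> M \otimes H) t a :
  mulr a (lift g t) = lift (fun u v => mulr a (g u v)) t.
Proof. by apply: lift_fuse; apply: mulr_bilinear.2. Qed.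

(** * The conditions as components of associativity *)

(** Conditions 1 and 2 are separated from the others because both directions compute with them: one
    extracts them from the unit laws of [mul], the other assumes them. *)
Definition unit_conditions : Prop :=
  ((forall x, e ** x = x /\ x ** e = x) /\
   (forall h, one ## h = h /\ h ## one = h)) /\
  ((forall x, theta x e = counit x *: one /\ theta e x = counit x *: one) /\
   (forall h, gamma h one = counit h *: e /\ gamma one h = counit h *: e)).

Section Unital.
Hypothesis U : unit_conditions.

Let phi_el x : e ** x = x. Proof. exact: (U.1.1 x).1. Qed.
Let phi_er x : x ** e = x. Proof. exact: (U.1.1 x).2. Qed.
Let mu_1l h : one ## h = h. Proof. exact: (U.1.2 h).1. Qed.
Let mu_1r h : h ## one = h. Proof. exact: (U.1.2 h).2. Qed.
Let theta_er x : theta x e = counit x *: one. Proof. exact: (U.2.1 x).1. Qed.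
Let theta_el x : theta e x = counit x *: one. Proof. exact: (U.2.1 x).2. Qed.
Let gamma_1r h : gamma h one = counit h *: e. Proof. exact: (U.2.2 h).1. Qed.
Let gamma_1l h : gamma one h = counit h *: e. Proof. exact: (U.2.2 h).2. Qed.

Lemma mulQ1l x' h' : mulQ one x' h' = counit h' *: x'.
Proof. by rewrite mulQ_one_l gamma_1l ptensZr linearZ /= phi_er. Qed.

Lemma mulQe h h' : mulQ h e h' = gamma h h'.
Proof. by rewrite mulQ_e phi_el. Qed.

Lemma mulQ1r h x' : mulQ h x' one = varphi h x'.
Proof.
rewrite /mulQ /sweedler2.
under eq_lift => h1 h2 do under eq_lift => x1 x2 do
  rewrite gamma_1r counit_op ptensZr linearZ /= phi_er.
by rewrite sw_counit2 //; lin.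
Qed.

Lemma mulR1 x x' : mulR x one x' = theta x x'.
Proof. by rewrite mulR_one mu_1r. Qed.

Lemma mulRer x h : mulR x h e = counit x *: h.
Proof. by rewrite mulR_e theta_er ptensZl linearZ /= mu_1l. Qed.

Lemma mulRel h x' : mulR e h x' = psi h x'.
Proof.
rewrite /mulR /sweedler2.
under eq_lift => h1 h2 do under eq_lift => x1 x2 do
  rewrite theta_el counit_op ptensZl linearZ /= mu_1l.
by rewrite sw_counit2l //; lin.
Qed.

(** In the three special products [mul_HM], [mul_MG] and [mul_GH] only one of the pairs ([varphi],
    [psi]), ([phi], [theta]), ([gamma], [mu]) supplies both tensor factors. They serve as the inner
    products in the triples behind conditions 3-10. *)
Lemma mul_HM h x : mul (e \ox h) (x \ox one) =
  lift (fun h1 h2 => lift (fun x1 x2 => varphi h1 x1 \ox psi h2 x2)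
    (comul x)) (comul h).
Proof.
have [ll lr] := mull_bilinear; have [rl rr] := mulr_bilinear.
rewrite mul_split sw_e_ox; last first.
  by split=> v; apply: lin_liftf => ? ?; [apply: lin_oxl | apply: lin_oxr].
apply: eq_lift => h1 h2; rewrite sw_ox_one; last first.
  by split=> v; [apply: lin_oxl | apply: lin_oxr].
apply: eq_lift => x1 x2.
by rewrite mullE mulrE mulQ1r mulRel phi_el mu_1r.
Qed.

Lemma mul_MG x x' h' : mul (x \ox one) (x' \ox h') =
  lift (fun x1 x2 => lift (fun x1' x2' => (x1 ** x1') \ox (theta x2 x2' ## h'))
    (comul x')) (comul x).
Proof.
have [ll lr] := mull_bilinear; have [rl rr] := mulr_bilinear.
rewrite mul_split sw_ox_one; last first.
  by split=> v; apply: lin_liftf => ? ?; [apply: lin_oxl | apply: lin_oxr].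
apply: eq_lift => x1 x2; rewrite sw_ox; last first.
  by split=> v; [apply: lin_oxl | apply: lin_oxr].
apply: eq_lift => x1' x2'.
under eq_lift => h1' h2' do
  rewrite mullE mulrE mulQ1l mulR1 ptensZr linearZ /= ptensZl.
by rewrite (@sw_counitl _ _ _ (fun h => _ \ox (theta x2 x2' ## h))) //; lin.
Qed.

Lemma mul_GH x h h' : mul (x \ox h) (e \ox h') =
  lift (fun h1 h2 => lift (fun h1' h2' => (x ** gamma h1 h1') \ox (h2 ## h2'))
    (comul h')) (comul h).
Proof.
have [ll lr] := mull_bilinear; have [rl rr] := mulr_bilinear.
rewrite mul_split sw_ox; last first.
  by split=> v; apply: lin_liftf => ? ?; [apply: lin_oxl | apply: lin_oxr].
rewrite lift_swap; apply: eq_lift => h1 h2.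
under eq_lift => x1 x2.
  rewrite sw_e_ox; last first.
    by split=> v; [apply: lin_oxl | apply: lin_oxr].
  under eq_lift => h1' h2' do
    rewrite mullE mulrE mulQe mulRer ptensZl linearZ /= ptensZr.
  rewrite -scaler_lift.
  over.
by rewrite (@sw_counitr _ _ _ (fun x => lift (fun h1' h2' =>
  (x ** gamma h1 h1') \ox _) _)) //; lin.
Qed.

Lemma mul_unitl : left_id (e \ox one) mul.
Proof.
have [ml mr] := bicocycle_mul_bilinear P.
apply: tens_ext => // x h.
rewrite mul_MG sw_grouplike //; last by lin.
under eq_lift => x1 x2 do
  rewrite phi_el theta_el ptensZl linearZ /= mu_1l ptensZr.
by rewrite sw_counitr //; lin.
Qed.

Lemma mul_unitr : right_id (e \ox one) mul.
Proof.
have [ml mr] := bicocycle_mul_bilinear P.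
apply: tens_ext => // x h.
rewrite mul_GH.
under eq_lift => h1 h2.
  rewrite sw_grouplike //; last by lin.
  rewrite gamma_1r mu_1r ptensZr linearZ /= phi_er ptensZl; over.
by rewrite sw_counitl //; lin.
Qed.

Ltac mul_simpl := first
  [ rewrite mull_liftl | rewrite mull_liftr | rewrite mulr_liftl
  | rewrite mulr_liftr | rewrite mullE | rewrite mulrE | rewrite mulQ1r
  | rewrite mulQe | rewrite mulR1 | rewrite mulRel | rewrite phi_el
  | rewrite mu_1r | progress rewrite /mulQ /mulR /sweedler2 ].

(** Here begin the identifications of the sides of conditions 3-10: conditions 3, 6, 7 and 9 are
    M-components of triple products, and 4, 5, 8 and 10 are H-components. *)
Lemma cond3_lhs h x' x'' h'' :
  \sw[h1, h2 <- h] \sw[x1', x2', x3' <- x'] \sw[x1'', x2'', x3'' <- x'']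
    (varphi h1 (x1' ** x1'') **
     gamma (psi h2 (x2' ** x2'')) (theta x3' x3'' ## h'')) =
  mull (e \ox h) (mul (x' \ox one) (x'' \ox h'')).
Proof. rewrite mul_MG. sw_normalize mul_simpl. Qed.

Lemma cond3_rhs h x' x'' h'' :
  \sw[h1, h2, h3 <- h] \sw[x1', x2', x3' <- x'] \sw[x1'', x2'' <- x'']
    (varphi h1 x1' **
     (varphi (psi h2 x2') x1'' ** gamma (psi (psi h3 x3') x2'') h'')) =
  mull (mul (e \ox h) (x' \ox one)) (x'' \ox h'').
Proof. rewrite mul_HM; sw_normalize mul_simpl. Qed.

Lemma cond4_lhs h x' x'' h'' :
  \sw[x1', x2' <- x'] \sw[x1'', x2'' <- x'']
    (psi h (x1' ** x1'') ## (theta x2' x2'' ## h'')) =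
  mulr (e \ox h) (mul (x' \ox one) (x'' \ox h'')).
Proof. rewrite mul_MG; sw_normalize mul_simpl. Qed.

Lemma cond4_rhs h x' x'' h'' :
  \sw[h1, h2, h3 <- h] \sw[x1', x2', x3' <- x'] \sw[x1'', x2'' <- x'']
    ((theta (varphi h1 x1') (varphi (psi h2 x2') x1'') ##
      psi (psi h3 x3') x2'') ## h'') =
  mulr (mul (e \ox h) (x' \ox one)) (x'' \ox h'').
Proof. rewrite mul_HM; sw_normalize mul_simpl. Qed.

Lemma cond5_lhs x h h' x'' :
  \sw[h1, h2, h3 <- h] \sw[h1', h2', h3' <- h'] \sw[x1'', x2'' <- x'']
    (theta (x ** gamma h1 h1') (varphi (h2 ## h2') x1'') ##
     psi (h3 ## h3') x2'') =
  mulr (mul (x \ox h) (e \ox h')) (x'' \ox one).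
Proof. rewrite mul_GH; sw_normalize mul_simpl. Qed.

Lemma cond5_rhs x h h' x'' :
  \sw[h1, h2 <- h] \sw[h1', h2', h3' <- h'] \sw[x1'', x2'', x3'' <- x'']
    ((theta x (varphi h1 (varphi h1' x1'')) ##
      psi h2 (varphi h2' x2'')) ## psi h3' x3'') =
  mulr (x \ox h) (mul (e \ox h') (x'' \ox one)).
Proof. rewrite mul_HM; sw_normalize mul_simpl. Qed.

Lemma cond6_lhs x h h' x'' :
  \sw[h1, h2 <- h] \sw[h1', h2' <- h']
    ((x ** gamma h1 h1') ** varphi (h2 ## h2') x'') =
  mull (mul (x \ox h) (e \ox h')) (x'' \ox one).
Proof. rewrite mul_GH; sw_normalize mul_simpl. Qed.

Lemma cond6_rhs x h h' x'' :
  \sw[h1, h2 <- h] \sw[h1', h2', h3' <- h'] \sw[x1'', x2'', x3'' <- x'']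
    (x ** (varphi h1 (varphi h1' x1'') **
           gamma (psi h2 (varphi h2' x2'')) (psi h3' x3''))) =
  mull (x \ox h) (mul (e \ox h') (x'' \ox one)).
Proof. rewrite mul_HM; sw_normalize mul_simpl. Qed.

(** The outer left factor has H-part [one], so [mulQ1l] applies the counit to the whole H-part of
    the inner product. The legs of [x'] and [x''] in it are absorbed and [counit h''] remains. In
    [cond10_lhs] the factor [counit x] arises symmetrically from [mulRer]. *)
Lemma cond7_lhs x x' x'' h'' :
  counit h'' *: (x ** (x' ** x'')) =
  mull (x \ox one) (mul (x' \ox one) (x'' \ox h'')).
Proof.
rewrite mul_MG mull_liftr.
under [RHS]eq_lift => x1' x2'.
  rewrite mull_liftr.
  under eq_lift => x1'' x2'' do
    rewrite mullE mulQ1l counit_op counit_op mulrC -scalerA ptensZr linearZ /=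
      ptensZr linearZ /=.
  rewrite -scaler_lift.
  over.
by rewrite -scaler_lift sw_counit2 //; lin.
Qed.

Lemma cond7_rhs x x' x'' h'' :
  \sw[x1, x2, x3 <- x] \sw[x1', x2', x3' <- x'] \sw[x1'', x2'' <- x'']
    ((x1 ** x1') **
     (varphi (theta x2 x2') x1'' ** gamma (psi (theta x3 x3') x2'') h'')) =
  mull (mul (x \ox one) (x' \ox one)) (x'' \ox h'').
Proof. rewrite mul_MG; sw_normalize mul_simpl. Qed.

Lemma cond8_lhs x x' x'' h'' :
  \sw[x1', x2' <- x'] \sw[x1'', x2'' <- x'']
    (theta x (x1' ** x1'') ## (theta x2' x2'' ## h'')) =
  mulr (x \ox one) (mul (x' \ox one) (x'' \ox h'')).
Proof. rewrite mul_MG; sw_normalize mul_simpl. Qed.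

Lemma cond8_rhs x x' x'' h'' :
  \sw[x1, x2, x3 <- x] \sw[x1', x2', x3' <- x'] \sw[x1'', x2'' <- x'']
    ((theta (x1 ** x1') (varphi (theta x2 x2') x1'') ##
      psi (theta x3 x3') x2'') ## h'') =
  mulr (mul (x \ox one) (x' \ox one)) (x'' \ox h'').
Proof. rewrite mul_MG; sw_normalize mul_simpl. Qed.

Lemma cond9_lhs x h h' h'' :
  \sw[h1, h2 <- h] \sw[h1', h2' <- h']
    ((x ** gamma h1 h1') ** gamma (h2 ## h2') h'') =
  mull (mul (x \ox h) (e \ox h')) (e \ox h'').
Proof. rewrite mul_GH; sw_normalize mul_simpl. Qed.

Lemma cond9_rhs x h h' h'' :
  \sw[h1, h2 <- h] \sw[h1', h2', h3' <- h'] \sw[h1'', h2'', h3'' <- h'']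
    (x ** (varphi h1 (gamma h1' h1'') **
           gamma (psi h2 (gamma h2' h2'')) (h3' ## h3''))) =
  mull (x \ox h) (mul (e \ox h') (e \ox h'')).
Proof. rewrite mul_GH; sw_normalize mul_simpl. Qed.

Lemma cond10_lhs x h h' h'' :
  counit x *: ((h ## h') ## h'') =
  mulr (mul (x \ox h) (e \ox h')) (e \ox h'').
Proof.
rewrite mul_GH mulr_liftl.
under [RHS]eq_lift => h1 h2.
  rewrite mulr_liftl.
  under eq_lift => h1' h2' do
    rewrite mulrE mulRer counit_op counit_op -scalerA ptensZl linearZ /=
      ptensZl linearZ /=.
  rewrite -scaler_lift.
  over.
by rewrite -scaler_lift sw_counit2l //; lin.
Qed.

Lemma cond10_rhs x h h' h'' :
  \sw[h1, h2 <- h] \sw[h1', h2', h3' <- h'] \sw[h1'', h2'', h3'' <- h'']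
    ((theta x (varphi h1 (gamma h1' h1'')) ##
      psi h2 (gamma h2' h2'')) ## (h3' ## h3'')) =
  mulr (x \ox h) (mul (e \ox h') (e \ox h'')).
Proof. rewrite mul_GH; sw_normalize mul_simpl. Qed.

End Unital.

(** * Necessity of the conditions *)

Lemma mul_unit_conditions :
  left_id (e \ox one) mul -> right_id (e \ox one) mul -> unit_conditions.
Proof.
move=> ul ur; have [[_ e1] [_ o1]] := (e_g, one_g).
(* These are the projections of the two unit laws. Setting [h] to [one] or [x] to [e] makes the
   normalizations applicable and yields the unit laws of [**] and [##]; with these, the same four
   equations reduce to condition 2. *)
have pl x h : e ** (x ** gamma one h) = counit h *: x.
  by have := congr1 (@prl _ _ _) (ul (x \ox h));
    rewrite prl_mul mullE mulQ_one_l prlE.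
have pr x h : x ** (e ** gamma h one) = counit h *: x.
  by have := congr1 (@prl _ _ _) (ur (x \ox h));
    rewrite prl_mul mullE mulQ_e prlE.
have ql x h : (theta e x ## one) ## h = counit x *: h.
  by have := congr1 (@prr _ _ _) (ul (x \ox h));
    rewrite prr_mul mulrE mulR_one prrE.
have qr x h : (theta x e ## h) ## one = counit x *: h.
  by have := congr1 (@prr _ _ _) (ur (x \ox h));
    rewrite prr_mul mulrE mulR_e prrE.
have er x : x ** e = x.
  by have := pr x one; rewrite bp_gamma_11 bp_phi_ee o1 scale1r.
have el x : e ** x = x.
  by have := pl x one; rewrite bp_gamma_11 er o1 scale1r.
have l1 h : one ## h = h.
  by have := ql e h; rewrite bp_theta_ee bp_mu_11 e1 scale1r.
have r1 h : h ## one = h.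
  by have := qr e h; rewrite bp_theta_ee l1 e1 scale1r.
split; split=> // [x|h]; split.
- by have := qr x one; rewrite !r1.
- by have := ql x one; rewrite !r1.
- by have := pr e h; rewrite !el.
- by have := pl e h; rewrite !el.
Qed.

Lemma sw_mul (W : lmodType k) (f : M \otimes H -> M \otimes H -> W) a b :
  comul (mul a b) =
    \sw[a1, a2 <- a] \sw[b1, b2 <- b] mul a1 b1 \ox mul a2 b2 ->
  bilinear_map f -> lift f (comul (mul a b)) =
  lift (fun a1 a2 => lift (fun b1 b2 => f (mul a1 b1) (mul a2 b2)) (comul b))
    (comul a).
Proof.
move=> ab fb; rewrite ab /sweedler2 lift_lift //; apply: eq_lift => a1 a2.
by rewrite lift_lift //; apply: eq_lift => b1 b2; apply: liftE.
Qed.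

(** This is [prl_prr_swap] at [mul a b], with the coproduct distributed over [a] and [b] by the
    hypothesis. *)
Lemma mul_projections_swap a b :
  comul (mul a b) =
    \sw[a1, a2 <- a] \sw[b1, b2 <- b] mul a1 b1 \ox mul a2 b2 ->
  lift (fun a1 a2 => lift (fun b1 b2 => mulr a1 b1 \ox mull a2 b2)
    (comul b)) (comul a) =
  lift (fun a1 a2 => lift (fun b1 b2 => mulr a2 b2 \ox mull a1 b1)
    (comul b)) (comul a).
Proof.
move=> ab; have := prl_prr_swap (mul a b).
rewrite !(sw_mul ab); try by lin.
move=> s; apply: etrans (etrans s _).
  by apply: eq_lift => a1 a2; apply: eq_lift => b1 b2; rewrite prl_mul prr_mul.
by apply: eq_lift => a1 a2; apply: eq_lift => b1 b2; rewrite prl_mul prr_mul.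
Qed.

Lemma bialgebra_conditions :
  is_bialgebra mul (e \ox one) -> bicocycle_conditions P.
Proof.
case=> mb mA ml mr mC _ _ _.
have U := mul_unit_conditions ml mr.
have [ll lr] := mull_bilinear; have [rl rr] := mulr_bilinear.
have swapb (a : M \otimes H) a' :
    bilinear_map (fun b1 b2 => mulr a b1 \ox mull a' b2).
  by split=> v; [apply: lin_oxl | apply: lin_oxr].
have swapb' (a : M \otimes H) a' :
    bilinear_map (fun b1 b2 => mulr a b2 \ox mull a' b1).
  by split=> v; [apply: lin_oxr | apply: lin_oxl].
have swapa (t : (M \otimes H) \otimes (M \otimes H)) :
    bilinear_map (fun a1 a2 => lift (fun b1 b2 => mulr a1 b1 \ox mull a2 b2) t).
  by split=> v; apply: lin_liftf => ? ?; [apply: lin_oxl | apply: lin_oxr].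
have swapa' (t : (M \otimes H) \otimes (M \otimes H)) :
    bilinear_map (fun a1 a2 => lift (fun b1 b2 => mulr a2 b2 \ox mull a1 b1) t).
  by split=> v; apply: lin_liftf => ? ?; [apply: lin_oxr | apply: lin_oxl].
have ue : forall x, e ** x = x by move=> x; case: (U.1.1 x).
have u1 : forall h, h ## one = h by move=> h; case: (U.1.2 h).
split; do ?[exact: U.1 | exact: U.2].
- by move=> *; rewrite (cond3_lhs U) (cond3_rhs U) -!prl_mul mA.
- by move=> *; rewrite (cond4_lhs U) (cond4_rhs U) -!prr_mul mA.
- by move=> *; rewrite (cond5_lhs U) (cond5_rhs U) -!prr_mul mA.
- by move=> *; rewrite (cond6_lhs U) (cond6_rhs U) -!prl_mul mA.
- by move=> *; rewrite (cond7_lhs U) (cond7_rhs U) -!prl_mul mA.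
- by move=> *; rewrite (cond8_lhs U) (cond8_rhs U) -!prr_mul mA.
- by move=> *; rewrite (cond9_lhs U) (cond9_rhs U) -!prl_mul mA.
- by move=> *; rewrite (cond10_lhs U) (cond10_rhs U) -!prr_mul mA.
(* On these arguments [mulr] and [mull] reduce to [psi] and [varphi]. The next two cases reduce them
   to [theta] and [phi], then to [mu] and [gamma]. *)
- move=> h x; have := mul_projections_swap (mC (e \ox h) (x \ox one)).
  rewrite !sw_e_ox // => s; apply/esym; apply: etrans (etrans s _).
    apply: eq_lift => h1 h2; rewrite sw_ox_one //; apply: eq_lift => x1 x2.
    by rewrite mullE mulrE (mulRel U) (mulQ1r U) ue u1.
  apply: eq_lift => h1 h2; rewrite sw_ox_one //; apply: eq_lift => x1 x2.
  by rewrite mullE mulrE (mulRel U) (mulQ1r U) ue u1.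
- move=> x x'; have := mul_projections_swap (mC (x \ox one) (x' \ox one)).
  rewrite !sw_ox_one // => s; apply/esym; apply: etrans (etrans s _).
    apply: eq_lift => x1 x2; rewrite sw_ox_one //; apply: eq_lift => y1 y2.
    by rewrite mullE mulrE (mulR1 U) (mulQ1r U) bp_varphi_one u1.
  apply: eq_lift => x1 x2; rewrite sw_ox_one //; apply: eq_lift => y1 y2.
  by rewrite mullE mulrE (mulR1 U) (mulQ1r U) bp_varphi_one u1.
- move=> h h'; have := mul_projections_swap (mC (e \ox h) (e \ox h')).
  rewrite !sw_e_ox // => s; apply/esym; apply: etrans (etrans s _).
    apply: eq_lift => h1 h2; rewrite sw_e_ox //; apply: eq_lift => y1 y2.
    by rewrite mullE mulrE (mulRel U) (mulQe U) bp_psi_e ue.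
  apply: eq_lift => h1 h2; rewrite sw_e_ox //; apply: eq_lift => y1 y2.
  by rewrite mullE mulrE (mulRel U) (mulQe U) bp_psi_e ue.
Qed.

Lemma lift_ptens (V W : lmodType k) (t : V \otimes W) :
  lift (fun v w => v \ox w) t = t.
Proof. by rewrite [RHS]tensE. Qed.

(** * From the conditions to a bialgebra *)

Section Backward.
Hypothesis B : bicocycle_conditions P.

Let U : unit_conditions.
Proof. by split; [exact: bc_cond1 B | exact: bc_cond2 B]. Qed.

Let phi_el x : e ** x = x. Proof. exact: (U.1.1 x).1. Qed.
Let mu_1r h : h ## one = h. Proof. exact: (U.1.2 h).2. Qed.

(** * Exchange of legs and compatibility of the product with the coproduct *)

Lemma varphi_psi_cocommute : cocommute (bp_varphi P) (bp_psi P).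
Proof.
apply: tens_ext => [||h x]; [by lin | by lin | rewrite !sw_ox; try by lin].
exact: (bc_cond11 B h x).
Qed.

Lemma phi_theta_cocommute : cocommute (bp_phi P) (bp_theta P).
Proof.
apply: tens_ext => [||x x']; [by lin | by lin | rewrite !sw_ox; try by lin].
exact: (bc_cond12 B x x').
Qed.

Lemma gamma_mu_cocommute : cocommute (bp_gamma P) (bp_mu P).
Proof.
apply: tens_ext => [||h h']; [by lin | by lin | rewrite !sw_ox; try by lin].
exact: (bc_cond13 B h h').
Qed.

(** Condition 7 at [h'' = one], where [mulQ1r] collapses the right-hand side to [varphi]. *)
Lemma phi_assoc x y z : x ** (y ** z) =
  lift (fun x1 x2 => lift (fun y1 y2 => (x1 ** y1) ** varphi (theta x2 y2) z)
    (comul y)) (comul x).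
Proof.
have := bc_cond7 B x y z one.
rewrite (cond7_rhs U) (proj2 one_g) scale1r => ->.
rewrite (mul_MG U) mull_liftl; apply: eq_lift => x1 x2.
rewrite mull_liftl; apply: eq_lift => y1 y2.
by rewrite mullE (mulQ1r U) mu_1r.
Qed.

(** Condition 10 at [x = e], where [mulRel] collapses the right-hand side to [psi]. *)
Lemma mu_assoc p h h' : (p ## h) ## h' =
  lift (fun h1 h2 => lift (fun h1' h2' => psi p (gamma h1 h1') ## (h2 ## h2'))
    (comul h')) (comul h).
Proof.
have := bc_cond10 B e p h h'.
rewrite (cond10_rhs U) (proj2 e_g) scale1r => ->.
rewrite (mul_GH U) mulr_liftr; apply: eq_lift => h1 h2.
rewrite mulr_liftr; apply: eq_lift => h1' h2'.
by rewrite mulrE (mulRel U) phi_el.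
Qed.

(** Iterated Sweedler sums split the last leg, so exchanging the first two legs requires regrouping
    by coassociativity. *)
Lemma sw3_cocommute12 (C D E : coalgType k) (W : lmodType k)
    (f : {linear C -> D}) (g : {linear C -> E}) (K : E -> D -> C -> W) c :
  cocommute f g -> (forall y z, linear (fun x => K x y z)) ->
  (forall x z, linear (fun y => K x y z)) -> (forall x y, linear (K x y)) ->
  lift (fun c1 r => lift (fun c2 c3 => K (g c2) (f c1) c3) (comul r))
    (comul c) =
  lift (fun c1 r => lift (fun c2 c3 => K (g c1) (f c2) c3) (comul r))
    (comul c).
Proof.
move=> fg K1 K2 K3.
rewrite -(@lift_coassoc _ _ _ (fun c1 c2 c3 => K (g c2) (f c1) c3));
  try by move=> *; do ?[exact: K3 | move=> a x y; rewrite linearP;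
    do ?[exact: K1 | exact: K2]].
rewrite -(@lift_coassoc _ _ _ (fun c1 c2 c3 => K (g c1) (f c2) c3));
  try by move=> *; do ?[exact: K3 | move=> a x y; rewrite linearP;
    do ?[exact: K1 | exact: K2]].
apply: eq_lift => s c3.
by apply: (cocommute_lift (K := fun x y => K x y c3)).
Qed.

(* With [u = x \ox y] and [v = l \ox h'], the two factors are the reassociated
   forms of [(theta x y ## l) ## h'] and [x ** (y ** gamma l h')] given by
   [mu_assoc] and [phi_assoc]. *)
Lemma reassociated_cocommute u v :
  \sw[u1, u2, u3 <- u] \sw[v1, v2, v3 <- v]
    (bp_psi P (bp_theta P u1 \ox bp_gamma P v1) ## bp_mu P v2) \ox
    (bp_phi P u2 ** bp_varphi P (bp_theta P u3 \ox bp_gamma P v3)) =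
  \sw[u1, u2, u3 <- u] \sw[v1, v2, v3 <- v]
    (bp_psi P (bp_theta P u3 \ox bp_gamma P v2) ## bp_mu P v3) \ox
    (bp_phi P u1 ** bp_varphi P (bp_theta P u2 \ox bp_gamma P v1)).
Proof.
have ut := phi_theta_cocommute; have vt := gamma_mu_cocommute.
pose K p q m x p' q' :=
  (bp_psi P (p \ox q) ## m) \ox (x ** bp_varphi P (p' \ox q')).
pose t := bp_theta P; pose g := bp_gamma P.
pose m := bp_mu P; pose f := bp_phi P.
(* In [K] the first two arguments feed [psi] and the last two feed [varphi]. The first two moves
   push [phi] to the last leg of [u] and [mu] to the first leg of [v], so that [psi] and [varphi]
   read adjacent legs. *)
transitivity (\sw[u1, u2, u3 <- u] \sw[v1, v2, v3 <- v]
    K (t u1) (g v1) (m v2) (f u3) (t u2) (g v3)).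
  rewrite /sweedler3 /sweedler2; apply: eq_lift => u1 r.
  apply: (cocommute_lift (K := fun a b => \sw[v1, v2, v3 <- v]
    K (t u1) (g v1) (m v2) b a (g v3)) _ ut).
  by rewrite /K; swlin.
transitivity (\sw[u1, u2, u3 <- u] \sw[v1, v2, v3 <- v]
    K (t u1) (g v2) (m v1) (f u3) (t u2) (g v3)).
  rewrite /sweedler3 /sweedler2; apply: eq_lift => u1 r.
  apply: eq_lift => u2 u3.
  apply: (sw3_cocommute12 (K := fun a b v3 =>
    K (t u1) b a (f u3) (t u2) (g v3)) _ vt); by rewrite /K; lin.
transitivity (\sw[u1, u2, u3 <- u] \sw[v1, v2, v3 <- v]
    K (t u2) (g v3) (m v1) (f u3) (t u1) (g v2)).
  (* As [theta] and [gamma] are coalgebra maps, the adjacent legs form the coproduct of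
     [t s \ox g r], to which condition 11 applies. *)
  transitivity (\sw[s, u3 <- u] \sw[v1, r <- v]
    lift (fun w1 w2 => (bp_psi P w1 ## m v1) \ox (f u3 ** bp_varphi P w2))
      (comul (t s \ox g r))).
    rewrite /K /t /g /m /f; sw_normalize idtac.
  transitivity (\sw[s, u3 <- u] \sw[v1, r <- v]
    lift (fun w1 w2 => (bp_psi P w2 ## m v1) \ox (f u3 ** bp_varphi P w1))
      (comul (t s \ox g r))).
    rewrite /sweedler2; apply: eq_lift => s u3; apply: eq_lift => v1 r.
    apply/esym; apply: (cocommute_lift (K := fun a b => (a ## m v1) \ox
      (f u3 ** b)) _ varphi_psi_cocommute); lin.
  rewrite /K /t /g /m /f; sw_normalize idtac.
(* The remaining moves carry [phi] to the first leg of [u] and [mu] to the last leg of [v]. *)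
transitivity (\sw[u1, u2, u3 <- u] \sw[v1, v2, v3 <- v]
    K (t u3) (g v3) (m v1) (f u2) (t u1) (g v2)).
  rewrite /sweedler3 /sweedler2; apply: eq_lift => u1 r.
  apply/esym; apply: (cocommute_lift (K := fun a b => \sw[v1, v2, v3 <- v]
    K a (g v3) (m v1) b (t u1) (g v2)) _ ut).
  by rewrite /K; swlin.
transitivity (\sw[u1, u2, u3 <- u] \sw[v1, v2, v3 <- v]
    K (t u3) (g v3) (m v1) (f u1) (t u2) (g v2)).
  rewrite /sweedler3 /sweedler2; apply/esym.
  apply: (sw3_cocommute12 (K := fun a b u3 => \sw[v1, v2, v3 <- v]
    K (t u3) (g v3) (m v1) b a (g v2)) _ ut); by rewrite /K; swlin.
transitivity (\sw[u1, u2, u3 <- u] \sw[v1, v2, v3 <- v]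
    K (t u3) (g v3) (m v2) (f u1) (t u2) (g v1)).
  rewrite /sweedler3 /sweedler2; apply: eq_lift => u1 r.
  apply: eq_lift => u2 u3.
  apply/esym; apply: (sw3_cocommute12 (K := fun a b v3 =>
    K (t u3) (g v3) a (f u1) (t u2) b) _ vt); by rewrite /K; lin.
rewrite /sweedler3 /sweedler2; apply: eq_lift => u1 r.
apply: eq_lift => u2 u3; apply: eq_lift => v1 s.
apply/esym; apply: (cocommute_lift (K := fun a b =>
  K (t u3) b a (f u1) (t u2) (g v1)) _ vt); by rewrite /K; lin.
Qed.

(** The middle argument [t] stands for the image of [h \ox x'] under [conv] of [varphi] and [psi];
    at that value [mull3] and [mulr3] are the two components of the product. Condition 11 then
    enters separately, through [conv]. *)
Definition mull3 (x : M) (t : M \otimes H) (h' : H) : M :=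
  lift (fun y l => x ** (y ** gamma l h')) t.

Definition mulr3 (x : M) (t : M \otimes H) (h' : H) : H :=
  lift (fun y l => (theta x y ## l) ## h') t.

Lemma mull3E x y l h' : mull3 x (y \ox l) h' = x ** (y ** gamma l h').
Proof. by rewrite /mull3 liftE //; lin. Qed.

Lemma mulr3E x y l h' : mulr3 x (y \ox l) h' = (theta x y ## l) ## h'.
Proof. by rewrite /mulr3 liftE //; lin. Qed.

Lemma comul_mull3 x t h' : comul (mull3 x t h') =
  \sw[x1, x2 <- x] \sw[t1, t2 <- t] \sw[h1, h2 <- h']
    mull3 x1 t1 h1 \ox mull3 x2 t2 h2.
Proof.
move: t; apply: tens_ext => [||y l]; rewrite /mull3; [by lin | by swlin | ].
rewrite -/(mull3 _ _ _) mull3E -[LHS]lift_ptens.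
sw_normalize ltac:(rewrite liftE; [ | by lin]).
Qed.

Lemma comul_mulr3 x t h' : comul (mulr3 x t h') =
  \sw[x1, x2 <- x] \sw[t1, t2 <- t] \sw[h1, h2 <- h']
    mulr3 x1 t1 h1 \ox mulr3 x2 t2 h2.
Proof.
move: t; apply: tens_ext => [||y l]; rewrite /mulr3; [by lin | by swlin | ].
rewrite -/(mulr3 _ _ _) mulr3E -[LHS]lift_ptens.
sw_normalize ltac:(rewrite liftE; [ | by lin]).
Qed.

(** For [t = y \ox l], the laws [mu_assoc] and [phi_assoc] turn the two sides into those of
    [reassociated_cocommute]. *)
Lemma mull3_mulr3_cocommute x t h' :
  \sw[x1, x2 <- x] \sw[t1, t2 <- t] \sw[h1, h2 <- h']
    mulr3 x2 t2 h2 \ox mull3 x1 t1 h1 =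
  \sw[x1, x2 <- x] \sw[t1, t2 <- t] \sw[h1, h2 <- h']
    mulr3 x1 t1 h1 \ox mull3 x2 t2 h2.
Proof.
move: t; apply: tens_ext => [||y l]; rewrite /mull3 /mulr3;
  [by swlin | by swlin | ].
apply/esym.
transitivity (\sw[x1, x2 <- x] \sw[y1, y2 <- y] \sw[l1, l2 <- l]
  \sw[m1, m2 <- h'] (((theta x1 y1 ## l1) ## m1) \ox
                     (x2 ** (y2 ** gamma l2 m2)))).
  sw_normalize ltac:(rewrite liftE; [ | by lin]).
transitivity (\sw[x1, x2 <- x] \sw[y1, y2 <- y] \sw[l1, l2 <- l]
  \sw[m1, m2 <- h'] (((theta x2 y2 ## l2) ## m2) \ox
                     (x1 ** (y1 ** gamma l1 m1)))); last first.
  sw_normalize ltac:(rewrite liftE; [ | by lin]).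
(apply: etrans (etrans (reassociated_cocommute (x \ox y) (l \ox h')) _);
  [sw_normalize ltac:(first [rewrite mu_assoc | rewrite phi_assoc])|]).
apply/esym.
sw_normalize ltac:(first [rewrite mu_assoc | rewrite phi_assoc]).
Qed.

Lemma counit_mull3 x t h' :
  counit (mull3 x t h') = counit x * counit t * counit h'.
Proof.
move: t; apply: (tens_ext (W := k^o)) => [a u v|a u v|y l].
- by rewrite /mull3 lift_linear ?linearP //; lin.
- by rewrite linearP /GRing.scale /=; ring.
by rewrite mull3E !counit_op counit_ptens; ring.
Qed.

Lemma counit_mulr3 x t h' :
  counit (mulr3 x t h') = counit x * counit t * counit h'.
Proof.
move: t; apply: (tens_ext (W := k^o)) => [a u v|a u v|y l].
- by rewrite /mulr3 lift_linear ?linearP //; lin.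
- by rewrite linearP /GRing.scale /=; ring.
by rewrite mulr3E !counit_op counit_ptens; ring.
Qed.

Lemma tens3_ext (A C D : coalgType k) (W : lmodType k)
    (f g : A \otimes (C \otimes D) -> W) :
  linear f -> linear g ->
  (forall a c d, f (a \ox (c \ox d)) = g (a \ox (c \ox d))) -> f =1 g.
Proof.
move=> fl gl fg; apply: tens_ext => // a.
by apply: (@tens_ext _ _ _ _ (fun w => f (a \ox w)) (fun w => g (a \ox w)))
  => [r y z|r y z|//]; rewrite (ptens_bilinear _ _).2 (fl, gl).
Qed.

(* [T] stands for [H \otimes M] and [tau] for [conv varphi psi]; an abstract [T]
   avoids slow unification in nested tensor products. *)
Section TwistedPair.
Variables (T : coalgType k) (tau : {linear T -> M \otimes H}).
Hypothesis tau_coalg : coalgebra_map tau.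

Definition mull4 (c : M \otimes (T \otimes H)) : M :=
  lift (fun x w => lift (fun t h' => mull3 x (tau t) h') w) c.

Definition mulr4 (c : M \otimes (T \otimes H)) : H :=
  lift (fun x w => lift (fun t h' => mulr3 x (tau t) h') w) c.

Lemma mull4_linear : linear mull4.
Proof. by rewrite /mull4 /mull3; lin. Qed.
Lemma mulr4_linear : linear mulr4.
Proof. by rewrite /mulr4 /mulr3; lin. Qed.

HB.instance Definition _ := GRing.isLinear.Build k _ _ _ mull4 mull4_linear.
HB.instance Definition _ := GRing.isLinear.Build k _ _ _ mulr4 mulr4_linear.

Lemma mull4E x t h' : mull4 (x \ox (t \ox h')) = mull3 x (tau t) h'.
Proof. by rewrite /mull4 /mull3 liftE; [rewrite liftE //; lin | lin]. Qed.

Lemma mulr4E x t h' : mulr4 (x \ox (t \ox h')) = mulr3 x (tau t) h'.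
Proof. by rewrite /mulr4 /mulr3 liftE; [rewrite liftE //; lin | lin]. Qed.

(** The same evaluation for the bundled linear map, the form that occurs in [conv] and
    [cocommute]. *)
Lemma linear_mull4E x t h' :
  (mull4 : {linear _ -> _}) (x \ox (t \ox h')) = mull3 x (tau t) h'.
Proof. exact: mull4E. Qed.

Lemma linear_mulr4E x t h' :
  (mulr4 : {linear _ -> _}) (x \ox (t \ox h')) = mulr3 x (tau t) h'.
Proof. exact: mulr4E. Qed.

Lemma mull4_coalgebra_map : coalgebra_map mull4.
Proof.
split; first exact: mull4_linear.
  apply: tens3_ext => [||x t h']; [by lin | by swlin | ].
  rewrite mull4E comul_mull3 /sweedler2.
  transitivity (\sw[x1, x2 <- x] \sw[t1, t2 <- t] \sw[h1, h2 <- h']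
    mull3 x1 (tau t1) h1 \ox mull3 x2 (tau t2) h2).
    apply: eq_lift => x1 x2; rewrite sw_coalgebra_map //.
    by rewrite /mull3; lin.
  apply/esym; rewrite /sweedler2; sw_expand ltac:(rewrite mull4E).
apply: (tens3_ext (W := k^o)) => [a u v|a u v|x t h'].
- by rewrite !linearP.
- by rewrite linearP.
by rewrite mull4E counit_mull3 !counit_ptens mulrA; case: tau_coalg => _ _ ->.
Qed.

Lemma mulr4_coalgebra_map : coalgebra_map mulr4.
Proof.
split; first exact: mulr4_linear.
  apply: tens3_ext => [||x t h']; [by lin | by swlin | ].
  rewrite mulr4E comul_mulr3 /sweedler2.
  transitivity (\sw[x1, x2 <- x] \sw[t1, t2 <- t] \sw[h1, h2 <- h']
    mulr3 x1 (tau t1) h1 \ox mulr3 x2 (tau t2) h2).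
    apply: eq_lift => x1 x2; rewrite sw_coalgebra_map //.
    by rewrite /mulr3; lin.
  apply/esym; rewrite /sweedler2; sw_expand ltac:(rewrite mulr4E).
apply: (tens3_ext (W := k^o)) => [a u v|a u v|x t h'].
- by rewrite !linearP.
- by rewrite linearP.
by rewrite mulr4E counit_mulr3 !counit_ptens mulrA; case: tau_coalg => _ _ ->.
Qed.

Lemma mull4_mulr4_cocommute : cocommute mull4 mulr4.
Proof.
apply: tens3_ext => [||x t h']; [by lin | by lin | ].
transitivity (\sw[x1, x2 <- x] \sw[t1, t2 <- tau t] \sw[h1, h2 <- h']
    mulr3 x2 t2 h2 \ox mull3 x1 t1 h1).
  apply: (@etrans _ _ (\sw[x1, x2 <- x] \sw[t1, t2 <- t] \sw[h1, h2 <- h']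
      mulr3 x2 (tau t2) h2 \ox mull3 x1 (tau t1) h1)).
    rewrite /sweedler2.
    sw_expand ltac:(first [rewrite linear_mull4E | rewrite linear_mulr4E]).
  rewrite /sweedler2; apply: eq_lift => x1 x2.
  by rewrite sw_coalgebra_map // /mull3 /mulr3; lin.
rewrite mull3_mulr3_cocommute.
apply: (@etrans _ _ (\sw[x1, x2 <- x] \sw[t1, t2 <- t] \sw[h1, h2 <- h']
    mulr3 x1 (tau t1) h1 \ox mull3 x2 (tau t2) h2)).
  rewrite /sweedler2; apply: eq_lift => x1 x2.
  by rewrite sw_coalgebra_map // /mull3 /mulr3; lin.
apply/esym; rewrite /sweedler2.
sw_expand ltac:(first [rewrite linear_mull4E | rewrite linear_mulr4E]).
Qed.

Definition mul3 (x : M) (t : T) (h' : H) : M \otimes H :=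
  \sw[x1, x2 <- x] \sw[t1, t2 <- t] \sw[h1, h2 <- h']
    mull3 x1 (tau t1) h1 \ox mulr3 x2 (tau t2) h2.

Lemma mul3_conv x t h' : conv mull4 mulr4 (x \ox (t \ox h')) = mul3 x t h'.
Proof.
rewrite /conv /mul3 /sweedler2.
sw_expand ltac:(first [rewrite linear_mull4E | rewrite linear_mulr4E]).
Qed.

(** [mul3] is [conv] of the cocommuting coalgebra maps [mull4] and [mulr4], hence
    comultiplicative. *)
Lemma comul_mul3 x t h' : comul (mul3 x t h') =
  \sw[x1, x2 <- x] \sw[t1, t2 <- t] \sw[h1, h2 <- h']
    mul3 x1 t1 h1 \ox mul3 x2 t2 h2.
Proof.
have [_ + _] := conv_coalgebra_map mull4_coalgebra_map mulr4_coalgebra_map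
  mull4_mulr4_cocommute.
rewrite -mul3_conv => ->; rewrite /sweedler2.
sw_expand ltac:(rewrite mul3_conv).
Qed.

End TwistedPair.

Lemma mull3_mulQ x h x' h' :
  mull3 x (conv (bp_varphi P) (bp_psi P) (h \ox x')) h' = x ** mulQ h x' h'.
Proof.
rewrite /conv sw_ox; last by lin.
rewrite /mull3 /mulQ /sweedler2 lift_lift; last by lin.
rewrite ox_liftr linear_lift; apply: eq_lift => h1 h2.
rewrite lift_lift; last by lin.
rewrite ox_liftr linear_lift; apply: eq_lift => x1 x2.
by rewrite liftE //; lin.
Qed.

Lemma mulr3_mulR x h x' h' :
  mulr3 x (conv (bp_varphi P) (bp_psi P) (h \ox x')) h' = mulR x h x' ## h'.
Proof.
rewrite /conv sw_ox; last by lin.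
rewrite /mulr3 /mulR /sweedler2 lift_lift; last by lin.
rewrite ox_liftl linear_lift; apply: eq_lift => h1 h2.
rewrite lift_lift; last by lin.
rewrite ox_liftl linear_lift; apply: eq_lift => x1 x2.
by rewrite liftE //; lin.
Qed.

Lemma mul_mul3 x h x' h' : mul (x \ox h) (x' \ox h') =
  mul3 (conv (bp_varphi P) (bp_psi P)) x (h \ox x') h'.
Proof.
have [ll lr] := mull_bilinear; have [rl rr] := mulr_bilinear.
rewrite mul_split sw_ox; last first.
  by split=> v; apply: lin_liftf => ? ?; [apply: lin_oxl | apply: lin_oxr].
rewrite /mul3 /sweedler2; apply: eq_lift => x1 x2.
rewrite sw_ox; last by rewrite /mull3 /mulr3; lin.
apply: eq_lift => h1 h2; rewrite sw_ox; last first.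
  by split=> v; [apply: lin_oxl | apply: lin_oxr].
apply: eq_lift => y1 y2; apply: eq_lift => m1 m2.
by rewrite mullE mulrE mull3_mulQ mulr3_mulR.
Qed.

Lemma comul_mul a b : comul (mul a b) =
  \sw[a1, a2 <- a] \sw[b1, b2 <- b] mul a1 b1 \ox mul a2 b2.
Proof.
have [ml mr] := bicocycle_mul_bilinear P.
have bil v u : bilinear_map (fun b1 b2 => mul v b1 \ox mul u b2).
  by split=> w; [apply: lin_oxl | apply: lin_oxr].
have bil' t : bilinear_map (fun a1 a2 =>
    lift (fun b1 b2 => mul a1 b1 \ox mul a2 b2) t).
  by split=> v; apply: lin_liftf => ? ?; [apply: lin_oxl | apply: lin_oxr].
rewrite /sweedler2.
move: a; apply: tens_ext => [||x h].
- by move=> r u v; rewrite ml linearP.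
- by apply: lin_lift; [exact: bil' | exact: linearP].
move: b; apply: tens_ext => [||x' h'].
- by move=> r u v; rewrite mr linearP.
- by apply: lin_liftf => u v; apply: lin_lift => //; exact: linearP.
rewrite sw_ox // mul_mul3 comul_mul3; last first.
  exact: conv_coalgebra_map (bp_varphi_coalg P) (bp_psi_coalg P)
    varphi_psi_cocommute.
rewrite /sweedler2; apply: eq_lift => x1 x2.
rewrite sw_ox; last first.
  by rewrite /mul3 /mull3 /mulr3; swlin.
apply: eq_lift => h1 h2; rewrite sw_ox //.
apply: eq_lift => y1 y2; apply: eq_lift => m1 m2.
by rewrite !mul_mul3.
Qed.

(** * The product as a coalgebra map and a criterion for associativity *)

Definition mulT : (M \otimes H) \otimes (M \otimes H) -> M \otimes H :=
  lift mul.

Lemma mulT_linear : linear mulT.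
Proof. exact: lift_linear (bicocycle_mul_bilinear P). Qed.

HB.instance Definition _ := GRing.isLinear.Build k _ _ _ mulT mulT_linear.

Lemma mulTE a b : (mulT : {linear _ -> _}) (a \ox b) = mul a b.
Proof. exact: liftE (bicocycle_mul_bilinear P) a b. Qed.

Lemma counit_prl (t : M \otimes H) : counit (prl t) = counit t.
Proof.
move: t; apply: (tens_ext (W := k^o)) => [a u v|a u v|x h].
- by rewrite !linearP.
- by rewrite linearP.
by rewrite prlE linearZ counit_ptens /= mulrC.
Qed.

Lemma mulT_coalgebra_map : coalgebra_map (mulT : {linear _ -> _}).
Proof.
split; first exact: mulT_linear.
  move=> t; move: t; apply: tens_ext => [||a b]; [by lin | by swlin | ].
  rewrite mulTE comul_mul /sweedler2 sw_ox; last by lin.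
  by apply: eq_lift => a1 a2; apply: eq_lift => b1 b2; rewrite !mulTE.
apply: (tens_ext (W := k^o)) => [a u v|a u v|a b].
- by rewrite !linearP.
- by rewrite linearP.
by rewrite mulTE -counit_prl prl_mul counit_mull counit_ptens.
Qed.

(** Both sides are coalgebra maps in the three arguments. By [prl_ox_prr] each is rebuilt from its
    projections, evaluated on the legs of [c1], [c2], [c3]. *)
Lemma mul_assoc_projections (C1 C2 C3 : coalgType k)
    (f1 : {linear C1 -> M \otimes H}) (f2 : {linear C2 -> M \otimes H})
    (f3 : {linear C3 -> M \otimes H}) :
  coalgebra_map f1 -> coalgebra_map f2 -> coalgebra_map f3 ->
  (forall c1 c2 c3, mull (mul (f1 c1) (f2 c2)) (f3 c3) =
                    mull (f1 c1) (mul (f2 c2) (f3 c3))) ->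
  (forall c1 c2 c3, mulr (mul (f1 c1) (f2 c2)) (f3 c3) =
                    mulr (f1 c1) (mul (f2 c2) (f3 c3))) ->
  forall c1 c2 c3, mul (mul (f1 c1) (f2 c2)) (f3 c3) =
                   mul (f1 c1) (mul (f2 c2) (f3 c3)).
Proof.
move=> f1C f2C f3C el er c1 c2 c3.
(* The product, and below the projections [p] and [q], are made opaque so that [sw_normalize] treats
   them as arbitrary linear maps; [pair_coalg] finds [mC] among the hypotheses. *)
have [m mC mE] : exists2 m : {linear (M \otimes H) \otimes (M \otimes H) -> _},
    coalgebra_map m & forall a b, m (a \ox b) = mul a b.
  by exists mulT; [exact: mulT_coalgebra_map | exact: mulTE].
have sw_m (p : {linear M \otimes H -> M})
    (q : {linear M \otimes H -> H}) :
  (forall c1 c2 c3, p (m (m (f1 c1 \ox f2 c2) \ox f3 c3)) =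
                    p (m (f1 c1 \ox m (f2 c2 \ox f3 c3)))) ->
  (forall c1 c2 c3, q (m (m (f1 c1 \ox f2 c2) \ox f3 c3)) =
                    q (m (f1 c1 \ox m (f2 c2 \ox f3 c3)))) ->
  lift (fun t1 t2 => p t1 \ox q t2)
    (comul (m (m (f1 c1 \ox f2 c2) \ox f3 c3))) =
  lift (fun t1 t2 => p t1 \ox q t2)
    (comul (m (f1 c1 \ox m (f2 c2 \ox f3 c3)))).
  by move=> pE qE; sw_normalize idtac; rewrite pE qE.
rewrite -[LHS]prl_ox_prr -[RHS]prl_ox_prr -!mE.
apply: sw_m => d1 d2 d3; rewrite !mE; [rewrite -[LHS]/(prl _) -[RHS]/(prl _)
  | rewrite -[LHS]/(prr _) -[RHS]/(prr _)].
  by rewrite !prl_mul el.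
by rewrite !prr_mul er.
Qed.

(** * Associativity, first on generators and then in general *)

Definition inM (x : M) : M \otimes H := x \ox one.
Definition inH (h : H) : M \otimes H := e \ox h.

Lemma inM_linear : linear inM. Proof. by rewrite /inM; lin. Qed.
Lemma inH_linear : linear inH. Proof. by rewrite /inH; lin. Qed.

HB.instance Definition _ := GRing.isLinear.Build k _ _ _ inM inM_linear.
HB.instance Definition _ := GRing.isLinear.Build k _ _ _ inH inH_linear.

Lemma inM_coalgebra_map : coalgebra_map (inM : {linear _ -> _}).
Proof.
split=> [|x|x]; first exact: inM_linear.
  by rewrite -[LHS]lift_ptens sw_ox_one //; lin.
by rewrite counit_ptens (proj2 one_g) mulr1.
Qed.

Lemma inH_coalgebra_map : coalgebra_map (inH : {linear _ -> _}).
Proof.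
split=> [|h|h]; first exact: inH_linear.
  by rewrite -[LHS]lift_ptens sw_e_ox //; lin.
by rewrite counit_ptens (proj2 e_g) mul1r.
Qed.

Lemma idfun_coalgebra_map (C : coalgType k) :
  coalgebra_map (idfun : {linear C -> C}).
Proof. by split=> // c; rewrite /sweedler2 /= lift_ptens. Qed.

Lemma mul_inM_inH x h : mul (inM x) (inH h) = x \ox h.
Proof.
rewrite /inM /inH (mul_GH U) sw_grouplike //; last by lin.
under eq_lift => h1 h2 do
  rewrite (U.2.2 h1).2 (U.1.2 h2).1 ptensZr linearZ /= (U.1.1 x).2 ptensZl.
by rewrite sw_counitl //; lin.
Qed.

Let assoc a b c := mul (mul a b) c = mul a (mul b c).

Let mul_linl := (bicocycle_mul_bilinear P).1.
Let mul_linr := (bicocycle_mul_bilinear P).2.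

Lemma assoc_ext1 b c :
  (forall x h, assoc (mul (inM x) (inH h)) b c) -> forall a, assoc a b c.
Proof.
move=> xh; rewrite /assoc.
apply: tens_ext => [r u v|r u v|x h]; rewrite ?mul_linl //.
by rewrite -mul_inM_inH; exact: xh.
Qed.

Lemma assoc_ext2 a c :
  (forall x h, assoc a (mul (inM x) (inH h)) c) -> forall b, assoc a b c.
Proof.
move=> xh; rewrite /assoc.
apply: tens_ext => [r u v|r u v|x h].
- by rewrite mul_linr mul_linl.
- by rewrite mul_linl mul_linr.
by rewrite -mul_inM_inH; exact: xh.
Qed.

Lemma assoc_ext3 a b :
  (forall x h, assoc a b (mul (inM x) (inH h))) -> forall c, assoc a b c.
Proof.
move=> xh; rewrite /assoc.
apply: tens_ext => [r u v|r u v|x h]; rewrite ?mul_linr //.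
by rewrite -mul_inM_inH; exact: xh.
Qed.

Lemma assoc_HMG h x g : assoc (inH h) (inM x) g.
Proof.
rewrite /assoc; apply: (mul_assoc_projections (f3 := idfun)
  inH_coalgebra_map inM_coalgebra_map (idfun_coalgebra_map _)) => c1 c2.
  apply: tens_ext => [||y l] /=.
  - by apply: mull_bilinear.2.
  - by move=> r u v; rewrite mul_linr mull_bilinear.2.
  by rewrite -(cond3_lhs U) -(cond3_rhs U) (bc_cond3 B).
apply: tens_ext => [||y l] /=.
- by apply: mulr_bilinear.2.
- by move=> r u v; rewrite mul_linr mulr_bilinear.2.
by rewrite -(cond4_lhs U) -(cond4_rhs U) (bc_cond4 B).
Qed.

Lemma assoc_MMG x x' g : assoc (inM x) (inM x') g.
Proof.
rewrite /assoc; apply: (mul_assoc_projections (f3 := idfun)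
  inM_coalgebra_map inM_coalgebra_map (idfun_coalgebra_map _)) => c1 c2.
  apply: tens_ext => [||y l] /=.
  - by apply: mull_bilinear.2.
  - by move=> r u v; rewrite mul_linr mull_bilinear.2.
  by rewrite -(cond7_lhs U) -(cond7_rhs U) (bc_cond7 B).
apply: tens_ext => [||y l] /=.
- by apply: mulr_bilinear.2.
- by move=> r u v; rewrite mul_linr mulr_bilinear.2.
by rewrite -(cond8_lhs U) -(cond8_rhs U) (bc_cond8 B).
Qed.

Lemma assoc_GHM g h x : assoc g (inH h) (inM x).
Proof.
rewrite /assoc; apply: (mul_assoc_projections (f1 := idfun)
  (idfun_coalgebra_map _) inH_coalgebra_map inM_coalgebra_map) => + c2 c3.
  apply: tens_ext => [||y l] /=.
  - by move=> r u v; rewrite mul_linl mull_bilinear.1.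
  - by apply: mull_bilinear.1.
  by rewrite -(cond6_lhs U) -(cond6_rhs U) (bc_cond6 B).
apply: tens_ext => [||y l] /=.
- by move=> r u v; rewrite mul_linl mulr_bilinear.1.
- by apply: mulr_bilinear.1.
by rewrite -(cond5_lhs U) -(cond5_rhs U) (bc_cond5 B).
Qed.

Lemma assoc_GHH g h h' : assoc g (inH h) (inH h').
Proof.
rewrite /assoc; apply: (mul_assoc_projections (f1 := idfun)
  (idfun_coalgebra_map _) inH_coalgebra_map inH_coalgebra_map) => + c2 c3.
  apply: tens_ext => [||y l] /=.
  - by move=> r u v; rewrite mul_linl mull_bilinear.1.
  - by apply: mull_bilinear.1.
  by rewrite -(cond9_lhs U) -(cond9_rhs U) (bc_cond9 B).
apply: tens_ext => [||y l] /=.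
- by move=> r u v; rewrite mul_linl mulr_bilinear.1.
- by apply: mulr_bilinear.1.
by rewrite -(cond10_lhs U) -(cond10_rhs U) (bc_cond10 B).
Qed.

Let gen a := (exists x, a = inM x) \/ (exists h, a = inH h).

Lemma assoc_gen_M a x g : gen a -> assoc a (inM x) g.
Proof. by case=> [[y ->]|[h ->]]; [exact: assoc_MMG | exact: assoc_HMG]. Qed.

Lemma assoc_H_gen g h c : gen c -> assoc g (inH h) c.
Proof. by case=> [[y ->]|[h' ->]]; [exact: assoc_GHM | exact: assoc_GHH]. Qed.

(** With [g = x * h], the factors cross over one at a time: [(a(xh))c = ((ax)h)c = (ax)(hc) =
    a(x(hc)) = a((xh)c)]. *)
Lemma assoc_gen_gen a g c : gen a -> gen c -> assoc a g c.
Proof.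
move=> ga gc; apply: assoc_ext2 => x h; rewrite /assoc.
rewrite (assoc_H_gen (inM x) h gc) -(assoc_gen_M x (mul (inH h) c) ga).
by rewrite -(assoc_H_gen (mul a (inM x)) h gc) (assoc_gen_M x (inH h) ga).
Qed.

Lemma mull_inM x t : mull (inM x) t = x ** prl t.
Proof.
move: t; apply: tens_ext => [||y l]; [exact: mull_bilinear.2 | by lin | ].
by rewrite /inM mullE (mulQ1l U) prlE.
Qed.

Lemma mulr_inH t h : mulr t (inH h) = prr t ## h.
Proof.
move: t; apply: tens_ext => [||y l]; [exact: mulr_bilinear.1 | by lin | ].
by rewrite /inH mulrE (mulRer U) prrE.
Qed.

(** In [mullE] the element [x] only multiplies from outside, so it can be pulled out of the
    M-component. Dually, [mulr_GMH] pulls the last H-factor out of the H-component. *)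
Lemma mull_MHG x h g :
  mull (mul (inM x) (inH h)) g = mull (inM x) (mul (inH h) g).
Proof.
rewrite mull_inM prl_mul mul_inM_inH.
move: g; apply: tens_ext => [||y l].
- exact: mull_bilinear.2.
- by lin; exact: mull_bilinear.2.
by rewrite /inH !mullE phi_el.
Qed.

Lemma mulr_GMH g y l :
  mulr (mul g (inM y)) (inH l) = mulr g (mul (inM y) (inH l)).
Proof.
rewrite mulr_inH prr_mul mul_inM_inH.
move: g; apply: tens_ext => [||x h].
- by lin; exact: mulr_bilinear.1.
- exact: mulr_bilinear.1.
by rewrite /inM !mulrE mu_1r.
Qed.

(** The chain is [x(h(yl)) = x((hy)l) = (x(hy))l = ((xh)y)l]; its middle step has generators at both
    ends. *)
Lemma mul_MHMH x h y l :
  mul (inM x) (mul (inH h) (mul (inM y) (inH l))) =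
  mul (mul (mul (inM x) (inH h)) (inM y)) (inH l).
Proof.
rewrite -(assoc_HMG h y (inH l)) -assoc_gen_gen; first last.
- by right; exists l.
- by left; exists x.
by rewrite (assoc_GHM (inM x) h y).
Qed.

Lemma assoc_MHG x h g : assoc (inM x) (inH h) g.
Proof.
rewrite /assoc; apply: (mul_assoc_projections (f3 := idfun)
  inM_coalgebra_map inH_coalgebra_map (idfun_coalgebra_map _)) => c1 c2.
  by move=> t; exact: mull_MHG.
apply: tens_ext => [||y l] /=.
- by apply: mulr_bilinear.2.
- by move=> r u v; rewrite mul_linr mulr_bilinear.2.
(* The H-component of [(xh)(yl)] is that of [((xh)y)l], which equals [x(h(yl))]. *)
by rewrite -mul_inM_inH -mulr_GMH -!prr_mul -mul_MHMH.
Qed.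

Lemma assoc_GMH g y l : assoc g (inM y) (inH l).
Proof.
apply: assoc_ext1 => x h.
by rewrite /assoc -mul_MHMH (assoc_MHG x h).
Qed.

(** With [c = x * h]: [(ab)(xh) = ((ab)x)h = (a(bx))h = a((bx)h) = a(b(xh))]. Writing the first
    argument as such a product then gives [mul_assoc]. *)
Lemma assoc_genl a b c : gen a -> assoc a b c.
Proof.
move=> ga; apply: assoc_ext3 => x h.
rewrite /assoc -(assoc_GMH (mul a b)).
rewrite (assoc_gen_gen b ga); last by left; exists x.
rewrite (assoc_gen_gen (mul b (inM x)) ga); last by right; exists h.
by rewrite (assoc_GMH b).
Qed.

Lemma mul_assoc : associative mul.
Proof.
move=> a b c; apply/esym; apply: assoc_ext1 => x h; rewrite /assoc.
have gx : gen (inM x) by left; exists x.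
have gh : gen (inH h) by right; exists h.
by rewrite !(assoc_genl _ _ gx) (assoc_genl _ _ gh).
Qed.

Lemma conditions_bialgebra : is_bialgebra mul (e \ox one).
Proof.
split.
- exact: bicocycle_mul_bilinear.
- exact: mul_assoc.
- exact: mul_unitl U.
- exact: mul_unitr U.
- exact: comul_mul.
- by rewrite -[LHS]lift_ptens sw_e_ox ?sw_grouplike //; lin.
- by move=> a b; rewrite -counit_prl prl_mul counit_mull.
- by rewrite counit_ptens (proj2 e_g) (proj2 one_g) mulr1.
Qed.

End Backward.

End Pair.

Theorem proposition3p5 (k : fieldType) (M H : coalgType k)
    (P : bicocycle_pair M H) :
  is_bialgebra (@bicocycle_mul k M H P) (bp_e P \ox bp_one P) <->
  bicocycle_conditions P.
Proof.
by split; [exact: bialgebra_conditions | exact: conditions_bialgebra].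
Qed.
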